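(* For the mini-batch stochastic subgradient algorithm described in the context, run for $T$ iterations with mini-batches of size $b$ on the objective $J(\mathbf{w})=\frac1N\sum_{i=1}^N\ell(\mathbf{w}^\top\mathbf{x}_i)+\frac\mu2\|\mathbf{w}\|^2$, the output $\bar{\mathbf{w}}(T)$ satisfies $$ \mathbb{E}\bigl[J(\bar{\mathbf{w}}(T))\bigr]-J(\mathbf{w}^* )\le\frac{30L^2}{\mu}\cdot\frac{K_b}{b}\cdot\frac1T, $$ both for $K_b=\mathbb{E}[\|\mathbf{Q}_b\|]$ and for $K_b=1+\frac{(b-1)(N\rho^2-1)}{N-1}$.
   Context: Data: $\mathbf{x}_1,\dots,\mathbf{x}_N\in\mathbb{R}^d$ with $\|\mathbf{x}_i\|\le1$; the loss $\ell$ is convex and $L$-Lipschitz ($L>0$), $\mu>0$, and $\mathbf{w}^*=\arg\min_{\mathbf{w}}J(\mathbf{w})$. $\mathbf{Q}\in\mathbb{R}^{N\times N}$ is the Gram matrix $\mathbf{Q}_{ij}=\mathbf{x}_i^\top\mathbf{x}_j$, $\|\cdot\|$ on matrices is the spectral norm, and $\rho^2=\|\mathbf{Q}\|/N$ (equivalently the spectral norm of $\frac1N\sum_i\mathbf{x}_i\mathbf{x}_i^\top$). $\mathbf{Q}_b$ is the $b\times b$ principal submatrix of $\mathbf{Q}$ indexed by a uniformly random subset $A\subset\{1,\dots,N\}$ with $|A|=b$. Algorithm: $\mathbf{w}(1)=\mathbf{0}$. For $t=1,\dots,T$: draw a uniformly random subset $A_t\subset\{1,\dots,N\}$ with $|A_t|=b$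 (independently across $t$), compute $\mathbf{g}_{A_t}\in\frac1b\sum_{j\in A_t}\partial\ell(\mathbf{w}(t)^\top\mathbf{x}_j)\mathbf{x}_j$, and set $\mathbf{w}(t+1)=(1-\mu\eta_t)\mathbf{w}(t)-\eta_t\mathbf{g}_{A_t}$ with step-size $\eta_t=1/(\mu t)$. The output is $\bar{\mathbf{w}}(T)=\frac2T\sum_{t=\lfloor T/2\rfloor+1}^T\mathbf{w}(t)$. *)

(* Defs.v *)
From HB Require Import structures.
From mathcomp Require Import all_boot all_order all_algebra.
From mathcomp Require Import all_classical all_reals all_analysis.
Set Implicit Arguments.
Unset Strict Implicit.
Unset Printing Implicit Defensive.
Import Order.TTheory GRing.Theory Num.Theory.
Import numFieldNormedType.Exports.
Local Open Scope classical_set_scope.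
Local Open Scope ring_scope.

(* The norm that the library puts on matrices is the maximum norm, hence the
   Euclidean and spectral norms below. *)

Definition dot (R : realType) (n : nat) (u v : 'cV[R]_n) : R :=
  (u^T *m v) 0 0.

Definition norm2 (R : realType) (n : nat) (u : 'cV[R]_n) : R :=
  Num.sqrt (dot u u).

Definition spectral_norm (R : realType) (m n : nat) (M : 'M[R]_(m, n)) : R :=
  sup [set norm2 (M *m v) | v in [set v : 'cV[R]_n | norm2 v <= 1]].

Definition gram (R : realType) (d N : nat) (x : 'I_N -> 'cV[R]_d) : 'M[R]_N :=
  \matrix_(i, j) dot (x i) (x j).

Definition principal_submx (R : realType) (N : nat) (Q : 'M[R]_N)
    (A : {set 'I_N}) : 'M[R]_#|A| :=
  mxsub (@enum_val _ (mem A)) (@enum_val _ (mem A)) Q.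

Definition rho2 (R : realType) (d N : nat) (x : 'I_N -> 'cV[R]_d) : R :=
  spectral_norm (gram x) / N%:R.

Definition expect (R : realType) (T : finType) (X : T -> R) : R :=
  (\sum_(u : T) X u) / #|T|%:R.

Definition batch (N b : nat) := {A : {set 'I_N} | #|A| == b}.

(* Under the uniform distribution on this type, the T batches are independent
   and each of them is uniform on the b-element subsets; the batch drawn at
   iteration i + 1 is om i. *)
Definition draws (N b T : nat) := {ffun 'I_T -> batch N b}.

Definition objective (R : realType) (d N : nat) (x : 'I_N -> 'cV[R]_d)
    (l : R -> R) (mu : R) (w : 'cV[R]_d) : R :=
  (\sum_(i < N) l (dot w (x i))) / N%:R + mu / 2 * norm2 w ^+ 2.

Definition subdifferential (R : realType) (l : R -> R) (z : R) : set R :=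
  [set s | forall y : R, l z + s * (y - z) <= l y].

Definition batch_subgradients (R : realType) (d N : nat)
    (x : 'I_N -> 'cV[R]_d) (l : R -> R) (A : {set 'I_N}) (w : 'cV[R]_d) :
    set 'cV[R]_d :=
  [set g | exists2 s : 'I_N -> R,
     (forall j, j \in A -> subdifferential l (dot w (x j)) (s j)) &
     g = #|A|%:R^-1 *: \sum_(j in A) s j *: x j].

Definition step_size (R : realType) (mu : R) (t : nat) : R := 1 / (mu * t%:R).

(* [w om t] is the iterate w(t) (only 1 <= t <= T + 1 matters) and [g om i] the
   subgradient used at iteration t = i + 1, when the draws are [om].  Any
   element of the set of mini-batch subgradients may be chosen; the last clause
   says that the choice does not look at batches that are yet to be drawn. *)
Definition minibatch_run (R : realType) (d N b T : nat)
    (x : 'I_N -> 'cV[R]_d) (l : R -> R) (mu : R)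
    (w : draws N b T -> nat -> 'cV[R]_d)
    (g : draws N b T -> 'I_T -> 'cV[R]_d) : Prop :=
  [/\ forall om : draws N b T, w om 1%N = 0,
      forall (om : draws N b T) (i : 'I_T),
        batch_subgradients x l (val (om i)) (w om i.+1) (g om i),
      forall (om : draws N b T) (i : 'I_T),
        w om i.+2 = (1 - mu * step_size mu i.+1) *: w om i.+1
                    - step_size mu i.+1 *: g om i
    & forall (om om' : draws N b T) (i : 'I_T),
        (forall j : 'I_T, (j <= i)%N -> om j = om' j) -> g om i = g om' i].

Definition output (R : realType) (d T : nat) (w : nat -> 'cV[R]_d) : 'cV[R]_d :=
  (2 / T%:R) *: \sum_((T %/ 2).+1 <= t < T.+1) w t.

(* Main.v *)
Require Import Defs.
From HB Require Import structures.
From mathcomp Require Import all_boot all_order all_algebra.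
From mathcomp Require Import all_classical all_reals all_analysis.
From mathcomp Require Import ring lra.
From mathcomp Require Import fingroup perm.
(** Put [kappa = K / b] and [D = L * sqrt kappa], and let [F] be the average
    loss. The descent argument uses the data through two facts: [F] is
    [D]-Lipschitz, and the mini-batch subgradients have second moment at most
    [25/4 * D ^ 2].

    Descent. With the step [1 / (mu * t)], the update reads
    [t (w(t+1) - wstar) = (t-1) (w(t) - wstar) - (g + mu wstar) / mu].
    The subgradient [g] is on average at least as good as a subgradient of [F]
    ([expect_run_subgradient_ge]), so expanding the square bounds
    [t^2 Delta(t+1)], where [Delta(t)] is the mean squared distance of [w(t)] to
    [wstar], by [(t-1)^2 Delta(t) - 2 (t-1) / mu * gap(t) + 37/4 (D / mu)^2]
    ([mean_sqdist_step]); here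
    [gap(t)] is the mean of [F(w) - F(wstar) + mu <wstar, w - wstar>], which is
    nonnegative because [wstar] is a minimizer. Dropping the gap gives
    [Delta(t+1) <= 37/4 (D / mu)^2 / t]. Dividing by [t-1] instead makes the
    recursion telescope and bounds the sum of the gaps of the objective over the
    last iterates ([recursion_sum]), hence the gap at their average, by
    convexity. When [T] is odd, the output is not this average but [1 + 1 / T]
    times it. The iterates are bounded in mean square, so the objective grows
    by a multiple of [D ^ 2 / (mu * T)] only ([scaled_excess_le]), and [30] is
    large enough for the sum of the two bounds once [T >= 5]; the cases [T = 1]
    and [T = 3] follow from the size of the iterates alone ([scaled_gap_le]).

    Data. If [K] is the mean spectral norm, the squared norm of a signed sum over
    a batch is a quadratic form of the Gram matrix of the batch, so both facts
    hold even without the factor [25/4]. For the other value of [K], the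
    difficulty is that the subgradients at the points of a batch may be chosen
    with knowledge of the whole batch, so that expanding the square and averaging
    over batches with fixed weights is not enough: the mean square of the
    largest signed sum has to be bounded. Such a sum [V] satisfies
    [|V|^2 <= \sum_(j in A) |<V, x_j>|], and this is compared with [b / N] times
    the sum over all points. The comparison is a symmetrization: a ghost batch
    is drawn outside of [A], points and ghosts are exchanged at random, and the
    contraction principle removes the absolute values ([contraction],
    [symmetrization], [batch_vs_population]). A quadratic penalty in [V] makes
    this argument work for second moments. A ghost batch exists if [2 b <= N];
    otherwise the batch is compared with the population directly. *)

Set Implicit Arguments.
Unset Strict Implicit.
Unset Printing Implicit Defensive.
Import Order.TTheory GRing.Theory Num.Theory.
Import numFieldNormedType.Exports.
Local Open Scope classical_set_scope.
Local Open Scope ring_scope.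

(** * The Euclidean inner product *)

Section InnerProduct.
Variables (R : realType) (n : nat).
Implicit Types (u v w : 'cV[R]_n) (c : R).

Lemma dotE u v : dot u v = \sum_i u i 0 * v i 0.
Proof. by rewrite /dot mxE; apply: eq_bigr => i _; rewrite mxE. Qed.

Lemma dotC u v : dot u v = dot v u.
Proof. by rewrite !dotE; apply: eq_bigr => i _; rewrite mulrC. Qed.

Lemma dotDl u v w : dot (u + v) w = dot u w + dot v w.
Proof.
by rewrite !dotE -big_split; apply: eq_bigr => i _; rewrite mxE mulrDl.
Qed.

Lemma dotZl c u w : dot (c *: u) w = c * dot u w.
Proof.
by rewrite !dotE mulr_sumr; apply: eq_bigr => i _; rewrite mxE mulrA.
Qed.

Lemma dotNl u w : dot (- u) w = - dot u w.
Proof. by rewrite -scaleN1r dotZl mulN1r. Qed.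

Lemma dotBl u v w : dot (u - v) w = dot u w - dot v w.
Proof. by rewrite dotDl dotNl. Qed.

Lemma dot0l w : dot 0 w = 0.
Proof. by rewrite -(scale0r 0) dotZl mul0r. Qed.

Lemma dotDr u v w : dot w (u + v) = dot w u + dot w v.
Proof. by rewrite !(dotC w) dotDl. Qed.

Lemma dotZr c u w : dot w (c *: u) = c * dot w u.
Proof. by rewrite !(dotC w) dotZl. Qed.

Lemma dotNr u w : dot w (- u) = - dot w u.
Proof. by rewrite !(dotC w) dotNl. Qed.

Lemma dotBr u v w : dot w (u - v) = dot w u - dot w v.
Proof. by rewrite !(dotC w) dotBl. Qed.

Lemma dot0r w : dot w 0 = 0.
Proof. by rewrite dotC dot0l. Qed.

Lemma dot_suml (I : Type) (r : seq I) (P : pred I) (F : I -> 'cV[R]_n) w :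
  dot (\sum_(i <- r | P i) F i) w = \sum_(i <- r | P i) dot (F i) w.
Proof.
by elim/big_rec2: _ => [|i y z _ <-]; [exact: dot0l | exact: dotDl].
Qed.

Lemma dot_sumr (I : Type) (r : seq I) (P : pred I) (F : I -> 'cV[R]_n) w :
  dot w (\sum_(i <- r | P i) F i) = \sum_(i <- r | P i) dot w (F i).
Proof. by rewrite dotC dot_suml; apply: eq_bigr => i _; rewrite dotC. Qed.

Lemma dot_ge0 u : 0 <= dot u u.
Proof. by rewrite dotE; apply: sumr_ge0 => i _; rewrite -expr2 sqr_ge0. Qed.

Lemma norm2_ge0 u : 0 <= norm2 u.
Proof. exact: sqrtr_ge0. Qed.

Lemma sqr_norm2 u : norm2 u ^+ 2 = dot u u.
Proof. by rewrite sqr_sqrtr // dot_ge0. Qed.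

Lemma norm2_0 : norm2 (0 : 'cV[R]_n) = 0.
Proof. by rewrite /norm2 dot0l sqrtr0. Qed.

Lemma norm2_eq0 u : norm2 u = 0 -> u = 0.
Proof.
move=> u0; have := sqr_norm2 u; rewrite u0 expr0n /= dotE => /esym/eqP.
rewrite psumr_eq0 => [/allP s0|i _]; last by rewrite -expr2 sqr_ge0.
apply/matrixP => i j; rewrite ord1 mxE; apply/eqP.
by have := s0 i (mem_index_enum i); rewrite /= mulf_eq0 orbb.
Qed.

Lemma norm2Z c u : norm2 (c *: u) = `|c| * norm2 u.
Proof.
by rewrite /norm2 dotZl dotZr mulrA -expr2 sqrtrM ?sqr_ge0 // sqrtr_sqr.
Qed.

Lemma norm2N u : norm2 (- u) = norm2 u.
Proof. by rewrite /norm2 dotNl dotNr opprK. Qed.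

Lemma cauchy_schwarz u v : dot u v <= norm2 u * norm2 v.
Proof.
have [/norm2_eq0-> | u0] := eqVneq (norm2 u) 0; first by rewrite dot0l norm2_0 mul0r.
have [/norm2_eq0-> | v0] := eqVneq (norm2 v) 0; first by rewrite dot0r norm2_0 mulr0.
have a0 : 0 < norm2 u by rewrite lt_def u0 norm2_ge0.
have c0 : 0 < norm2 v by rewrite lt_def v0 norm2_ge0.
have := dot_ge0 (norm2 v *: u - norm2 u *: v).
rewrite !(dotBl, dotBr, dotZl, dotZr) -!sqr_norm2 (dotC v u).
move: (mulr_gt0 a0 c0).
set a := norm2 u; set c := norm2 v; set p := dot u v => ac0 h.
have : 0 <= (a * c) * (a * c - p) by nra.
by rewrite pmulr_rge0 // subr_ge0.
Qed.

Lemma normr_dot_le u v : `|dot u v| <= norm2 u * norm2 v.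
Proof.
rewrite ler_norml cauchy_schwarz andbT lerNl -dotNl.
by rewrite (le_trans (cauchy_schwarz _ _)) // norm2N.
Qed.

Lemma dot_normalized u : dot u u = norm2 u * norm2 u.
Proof. by rewrite -sqr_norm2 expr2. Qed.

End InnerProduct.

Lemma le_amgm (R : realFieldType) (c t u z : R) :
  0 < c -> 0 <= u -> 0 <= z -> t ^+ 2 <= u * z -> t <= c * z + u / (4 * c).
Proof.
move=> c0 u0 z0 tuz; have [t0|t_gt0] := leP t 0.
  by rewrite (le_trans t0) // addr_ge0 ?divr_ge0 ?mulr_ge0 // ltW.
rewrite -(@ler_pXn2r _ 2) ?nnegrE ?(ltW t_gt0) //; last first.
  by rewrite addr_ge0 ?divr_ge0 ?mulr_ge0 // ltW.
apply: (le_trans tuz); rewrite -subr_ge0.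
rewrite (_ : _ - _ = (c * z - u / (4 * c)) ^+ 2) ?sqr_ge0 //.
by field; rewrite gt_eqF.
Qed.

(** * Uniform averages over a finite type *)

Section Expectation.
Variables (R : realType) (T : finType).
Implicit Types (X Y : T -> R) (c : R).

Lemma eq_expect X Y : X =1 Y -> expect X = expect Y.
Proof. by move=> e; rewrite /expect (eq_bigr _ (fun u _ => e u)). Qed.

Lemma expectD X Y : expect (fun u => X u + Y u) = expect X + expect Y.
Proof. by rewrite /expect big_split mulrDl. Qed.

Lemma expectZ c X : expect (fun u => c * X u) = c * expect X.
Proof. by rewrite /expect -mulr_sumr mulrA. Qed.

Lemma expectN X : expect (fun u => - X u) = - expect X.
Proof. by rewrite /expect sumrN mulNr. Qed.

Lemma expectB X Y : expect (fun u => X u - Y u) = expect X - expect Y.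
Proof. by rewrite expectD expectN. Qed.

Lemma expect_sum (I : Type) (r : seq I) (P : pred I) (X : I -> T -> R) :
  expect (fun u => \sum_(i <- r | P i) X i u)
  = \sum_(i <- r | P i) expect (X i).
Proof. by rewrite /expect exchange_big /= mulr_suml. Qed.

Lemma le_expect X Y : (forall u, X u <= Y u) -> expect X <= expect Y.
Proof. by move=> h; rewrite ler_wpM2r ?invr_ge0 // ler_sum. Qed.

Lemma expect_ge0 X : (forall u, 0 <= X u) -> 0 <= expect X.
Proof. by move=> h; rewrite divr_ge0 // sumr_ge0. Qed.

Lemma expect_cst c : (0 < #|T|)%N -> expect (fun _ : T => c) = c.
Proof.
move=> T0; rewrite /expect sumr_const -[c *+ _]mulr_natr mulfK //.
by rewrite pnatr_eq0 -lt0n.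
Qed.

Lemma expect_inj (h : T -> T) X : injective h ->
  expect (fun u => X (h u)) = expect X.
Proof. by move=> hI; rewrite /expect [in RHS](reindex_inj hI). Qed.

(** Jensen for the square: the variance of [X] is nonnegative. *)
Lemma sqr_expect_le X : expect X ^+ 2 <= expect (fun u => X u ^+ 2).
Proof.
have [T0|] := posnP #|T|.
  rewrite /expect T0 invr0 !mulr0 expr0n //=.
move=> T0; have : 0 <= expect (fun u => (X u - expect X) ^+ 2).
  by apply: expect_ge0 => u; rewrite sqr_ge0.
rewrite (eq_expect (Y := fun u => X u ^+ 2 - 2 * expect X * X u + expect X ^+ 2)).
  by rewrite expectD expectB expectZ expect_cst //; nra.
by move=> u; ring.
Qed.

End Expectation.

Lemma expect_exchange (R : realType) (S T : finType) (X : S -> T -> R) :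
  expect (fun u => expect (X u)) = expect (fun v => expect (X^~ v)).
Proof.
rewrite /expect -!mulr_suml exchange_big /= -!mulrA; congr (_ * _).
by rewrite mulrC.
Qed.

(** * Rademacher averages *)

Section Rademacher.
Variables (R : realType) (I : finType).
Implicit Types (e : {ffun I -> bool}) (i j : I).

Definition sgn e i : R := (-1) ^+ e i.

Definition flip i e : {ffun I -> bool} := [ffun j => (j == i) (+) e j].

Lemma flipK i : involutive (flip i).
Proof. by move=> e; apply/ffunP => j; rewrite !ffunE addbA addbb. Qed.

Lemma sgn_flip i e : sgn (flip i e) i = - sgn e i.
Proof. by rewrite /sgn ffunE eqxx; case: (e i); rewrite ?expr0 ?expr1 ?opprK. Qed.

Lemma sgn_flip_neq i j e : j != i -> sgn (flip i e) j = sgn e j.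
Proof. by rewrite /sgn ffunE => /negPf->. Qed.

(** The terms of [e] and [flip i e] see the points [u e] and [u (flip i e)]
    through the same [c] and through opposite signs of [f]. Exchanging the two
    points if necessary, [g] takes its larger value where its sign is
    positive, and the gain is [`|g x - g y|], which dominates [`|f x - f y|]. *)
Lemma contraction_step (U : Type) i (c : {ffun I -> bool} -> U -> R)
    (f g : U -> R) (u : {ffun I -> bool} -> U) :
  (forall e x, c (flip i e) x = c e x) ->
  (forall x y, `|f x - f y| <= `|g x - g y|) ->
  exists v : {ffun I -> bool} -> U,
    \sum_e (c e (u e) + sgn e i * f (u e))
    <= \sum_e (c e (v e) + sgn e i * g (v e)).
Proof.
move=> c_flip fg.
pose aligned e := 0 <= sgn e i * (g (u e) - g (u (flip i e))).
exists (fun e => if aligned e then u e else u (flip i e)).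
have fold (X : {ffun I -> bool} -> R) :
    \sum_e X e = 2^-1 * \sum_e (X e + X (flip i e)).
  have X_flip : \sum_e X (flip i e) = \sum_e X e.
    by rewrite [RHS](reindex_inj (can_inj (flipK i))).
  by rewrite big_split /= X_flip; lra.
rewrite [leLHS]fold [leRHS]fold ler_wpM2l ?invr_ge0 // ler_sum // => e _.
have alignedF : aligned (flip i e) = aligned e.
  by rewrite /aligned flipK sgn_flip -[in RHS](opprB (g (u (flip i e)))) mulrN mulNr.
rewrite alignedF flipK !c_flip sgn_flip.
have := fg (u e) (u (flip i e)); rewrite /aligned /sgn.
have [d0|d0] := lerP 0 (g (u e) - g (u (flip i e)));
  rewrite ?(ger0_norm d0) ?(ltr0_norm d0) ler_norml => /andP[];
  case: (e i); rewrite ?expr1 ?expr0 ?mulN1r ?mul1r;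
  case: ifPn; lra.
Qed.

(** The contraction principle for Rademacher averages. The usual supremum over
    [U], which may be infinite here, is expressed by the choice functions [u]
    and [v]: whatever [u] achieves with the [p i], some [v] achieves with the
    [q i]. The coordinates are treated one after the other. *)
Lemma contraction (U : Type) (c : U -> R) (p q : I -> U -> R)
    (u : {ffun I -> bool} -> U) :
  (forall i x y, `|p i x - p i y| <= `|q i x - q i y|) ->
  exists v : {ffun I -> bool} -> U,
    \sum_e (c (u e) + \sum_i sgn e i * p i (u e))
    <= \sum_e (c (v e) + \sum_i sgn e i * q i (v e)).
Proof.
move=> pq.
pose mix (s : seq I) i := if i \in s then q i else p i.
suff [v] : exists v : {ffun I -> bool} -> U,
    \sum_e (c (u e) + \sum_i sgn e i * p i (u e))
    <= \sum_e (c (v e) + \sum_i sgn e i * mix (enum I) i (v e)).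
  move=> h; exists v; apply: (le_trans h); apply: ler_sum => e _.
  by rewrite lerD2l ler_sum // => i _; rewrite /mix mem_enum.
elim: (enum I) (enum_uniq I) => [_|i s IH /= /andP[i_s s_uniq]].
  by exists u.
have [v hv] := IH s_uniq.
pose c' e x := c x + \sum_(j | j != i) sgn e j * mix s j x.
have [||v' hv'] := @contraction_step U i c' (p i) (q i) v.
- move=> e x; congr (_ + _); apply: eq_bigr => j ji.
  by rewrite sgn_flip_neq.
- exact: pq.
exists v'; apply: (le_trans hv); apply: le_trans (le_trans _ hv') _.
  apply: ler_sum => e _; rewrite (bigD1 i) //= {1}/mix (negPf i_s) /c'.
  by rewrite addrA addrAC.
apply: ler_sum => e _; rewrite [in leRHS](bigD1 i) //= /mix mem_head /c'.
rewrite [in leRHS]addrCA [in leRHS]addrC -!addrA lerD2l.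
rewrite lerD2r; apply: ler_sum => j ji.
by rewrite /mix inE (negPf ji).
Qed.

Lemma expect_sgnM i j : expect (fun e => sgn e i * sgn e j) = (i == j)%:R.
Proof.
have [<-|ij] := eqVneq i j.
  rewrite (eq_expect (Y := fun=> 1)) ?expect_cst //.
    by rewrite card_ffun expn_gt0 card_bool.
  by move=> e; rewrite -expr2 sqrr_sign.
have := expect_inj (fun e => sgn e i * sgn e j) (can_inj (flipK i)).
rewrite (eq_expect (Y := fun e => - (sgn e i * sgn e j))); last first.
  by move=> e; rewrite sgn_flip sgn_flip_neq 1?eq_sym // mulNr.
by rewrite expectN => /= h; lra.
Qed.

Lemma expect_sqr_rademacher (n : nat) (a : I -> 'cV[R]_n) :
  expect (fun e => dot (\sum_i sgn e i *: a i) (\sum_i sgn e i *: a i))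
  = \sum_i dot (a i) (a i).
Proof.
rewrite (eq_expect (Y := fun e =>
    \sum_i \sum_j dot (a i) (a j) * (sgn e i * sgn e j))); last first.
  move=> e; rewrite dot_suml; apply: eq_bigr => i _.
  rewrite dot_sumr; apply: eq_bigr => j _.
  by rewrite dotZl dotZr; ring.
rewrite expect_sum; apply: eq_bigr => i _; rewrite expect_sum (bigD1 i) //=.
rewrite expectZ expect_sgnM eqxx mulr1 big1 ?addr0 // => j ji.
by rewrite expectZ expect_sgnM eq_sym (negPf ji) mulr0.
Qed.

(** After contraction the functions [h i] disappear and the best choice of [v]
    completes a square. The quadratic penalty is what allows [v] to range over
    the whole space, and it yields a bound on second moments. *)
Lemma rademacher_lipschitz (n : nat) (a : I -> 'cV[R]_n) (h : I -> R -> R)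
    (c : R) (v : {ffun I -> bool} -> 'cV[R]_n) :
  0 < c -> (forall i s t, `|h i s - h i t| <= `|s - t|) ->
  expect (fun e => \sum_i sgn e i * h i (dot (v e) (a i))
                   - c * dot (v e) (v e))
  <= (\sum_i dot (a i) (a i)) / (4 * c).
Proof.
move=> c0 hL.
have [v' hv'] := @contraction _ (fun x => - (c * dot x x))
  (fun i x => h i (dot x (a i))) (fun i x => dot x (a i)) v
  (fun i x y => hL i _ _).
rewrite -expect_sqr_rademacher mulrC -expectZ /expect ler_wpM2r ?invr_ge0 //.
under eq_bigr do rewrite addrC.
apply: (le_trans hv'); apply: ler_sum => e _.
set A := \sum_i _ *: _.
rewrite (_ : \sum_i _ = dot (v' e) A); last first.
  by rewrite dot_sumr; apply: eq_bigr => i _; rewrite dotZr.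
rewrite -subr_ge0 (_ : _ - _ =
    (4 * c)^-1 * dot (2 * c *: v' e - A) (2 * c *: v' e - A)).
  by rewrite mulr_ge0 ?dot_ge0 // invr_ge0 mulr_ge0 // ltW.
rewrite !(dotBl, dotBr, dotZl, dotZr) (dotC A).
by field; rewrite gt_eqF.
Qed.

End Rademacher.

(** * Sampling without replacement *)

Section Batches.
Variables (R : realType) (N b : nat).
Implicit Types (A B : batch N b) (s : {perm 'I_N}).

Lemma card_batch A : #|val A| = b.
Proof. exact/eqP/(valP A). Qed.

Fact perm_batch_subproof s A : #|s @: val A| == b.
Proof. by rewrite card_imset ?card_batch //; apply: perm_inj. Qed.

Definition perm_batch s A : batch N b :=
  exist _ (s @: val A) (perm_batch_subproof s A).

Lemma perm_batchM s1 s2 A :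
  perm_batch (s1 * s2)%g A = perm_batch s2 (perm_batch s1 A).
Proof.
apply: val_inj; rewrite /= -imset_comp; apply: eq_imset => i /=.
by rewrite permM.
Qed.

Lemma perm_batch_inj s : injective (perm_batch s).
Proof.
move=> A B /(congr1 val) /= AB; apply: val_inj.
exact: imset_inj perm_inj _ _ AB.
Qed.

(** The permutation matches the listings of [A] and [B] that begin with the
    elements of the batch. *)
Lemma perm_batch_trans A B : exists s, perm_batch s A = B.
Proof.
pose listing (C : batch N b) := enum (val C) ++ enum (~: val C).
have listing_uniq C : uniq (listing C).
  rewrite cat_uniq !enum_uniq /= andbT; apply/hasPn => i.
  by rewrite !mem_enum inE.
have mem_listing C i : i \in listing C.
  by rewrite mem_cat !mem_enum inE orbN.
have size_listing C : size (listing C) = N.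
  by rewrite size_cat -!cardE cardsC card_ord.
pose f i := nth i (listing B) (index i (listing A)).
have f_inj : injective f.
  have idx_lt i C D : (index i (listing C) < size (listing D))%N.
    by move: (mem_listing C i); rewrite -index_mem !size_listing.
  move=> i j; rewrite /f (set_nth_default j) // => /eqP.
  rewrite nth_uniq // => /eqP idx.
  by rewrite -(nth_index j (mem_listing A i)) idx nth_index.
exists (perm f_inj); apply/val_inj/eqP; rewrite eqEcard /= card_batch.
rewrite card_imset ?card_batch ?leqnn ?andbT; last exact: perm_inj.
apply/fintype.subsetP => _ /imsetP[i iA ->]; rewrite permE /f /listing.
have iA' : i \in enum (val A) by rewrite mem_enum.
have lt_idx : (index i (enum (val A)) < size (enum (val B)))%N.
  by move: iA'; rewrite -index_mem -!cardE !card_batch.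
by rewrite index_cat iA' nth_cat lt_idx -(mem_enum (val B)) mem_nth.
Qed.

Lemma batch_inhabited : (b <= N)%N -> (0 < #|{: batch N b}|)%N.
Proof.
move=> bN; have A_card : #|[set widen_ord bN k | k in 'I_b]%SET| == b.
  by rewrite card_imset ?card_ord // => i j /(congr1 val) ij; apply: val_inj.
by apply/card_gt0P; exists (exist (fun A : {set 'I_N} => #|A| == b) _ A_card).
Qed.

(** The group of permutations acts transitively on batches, so the image of a
    fixed batch by a uniform permutation is a uniform batch. All averages over
    batches are computed in this way. *)
Lemma expect_batch A (X : batch N b -> R) :
  expect X = expect (fun s => X (perm_batch s A)).
Proof.
have perm_gt0 : (0 < #|{perm 'I_N}|)%N by apply/card_gt0P; exists 1%g.
have batch_gt0 : (0 < #|{: batch N b}|)%N by apply/card_gt0P; exists A.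
rewrite -(expect_cst (expect X) perm_gt0).
rewrite (eq_expect (fun s => esym (expect_inj X (@perm_batch_inj s)))).
rewrite expect_exchange -[RHS](expect_cst _ batch_gt0).
apply: eq_expect => B; have [s <-] := perm_batch_trans A B.
rewrite -[RHS](expect_inj _ (@mulgI _ s)).
by apply: eq_expect => t; rewrite perm_batchM.
Qed.

Lemma expect_perm_at (f : 'I_N -> R) i :
  expect (fun s => f (s i)) = expect f.
Proof.
have ord_gt0 : (0 < #|'I_N|)%N by apply/card_gt0P; exists i.
have perm_gt0 : (0 < #|{perm 'I_N}|)%N by apply/card_gt0P; exists 1%g.
rewrite -[LHS](expect_cst _ ord_gt0) -[RHS](expect_cst _ perm_gt0).
rewrite (eq_expect (Y := fun j => expect (fun s => f (s j)))) => [|j].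
  rewrite expect_exchange; apply: eq_expect => s.
  exact: expect_inj perm_inj.
rewrite -(expect_inj _ (@mulgI _ (tperm i j))).
by apply: eq_expect => s; rewrite permM tpermL.
Qed.

Lemma sum_perm_batch s A (f : 'I_N -> R) :
  \sum_(i in val (perm_batch s A)) f i = \sum_(i in val A) f (s i).
Proof. by rewrite big_imset //= => i j _ _; apply: perm_inj. Qed.

Lemma expect_batch_sum (f : 'I_N -> R) : (0 < #|{: batch N b}|)%N ->
  expect (fun A => \sum_(i in val A) f i) = b%:R * expect f.
Proof.
case/card_gt0P => A _; rewrite (expect_batch A).
under eq_expect do rewrite sum_perm_batch.
rewrite expect_sum (eq_bigr _ (fun i _ => expect_perm_at f i)) sumr_const.
by rewrite card_batch mulr_natl.
Qed.

(** Given the image of the batch, [s i] is uniform in its complement: a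
    transposition of two points outside of [A] does not move the image. *)
Lemma expect_perm_outside A (f : batch N b -> 'I_N -> R) i : i \notin val A ->
  (N - b)%:R * expect (fun s => f (perm_batch s A) (s i))
  = expect (fun B => \sum_(j in ~: val B) f B j).
Proof.
move=> iA; rewrite (expect_batch A).
under [RHS]eq_expect => s.
  rewrite (_ : ~: val _ = s @: (~: val A)); last first.
    apply/esym/eqP; rewrite eqEcard cardsCs finset.setCK card_ord card_batch.
    rewrite card_imset; last exact: perm_inj.
    rewrite cardsCs finset.setCK card_ord card_batch leqnn andbT.
    apply/fintype.subsetP => _ /imsetP[j jA ->]; rewrite !inE in jA *.
    by rewrite mem_imset //; exact: perm_inj.
  rewrite big_imset /=; last by move=> j k _ _; apply: perm_inj.
  over.
rewrite expect_sum (eq_bigr (fun=> expect (fun s => f (perm_batch s A) (s i)))).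
  rewrite sumr_const cardsCs finset.setCK card_ord card_batch mulr_natl //.
move=> j; rewrite inE => jA; rewrite -(expect_inj _ (@mulgI _ (tperm i j))).
apply: eq_expect => s; rewrite permM tpermR perm_batchM; congr (f (perm_batch s _) _).
apply/val_inj => /=.
rewrite -[RHS]imset_id; apply: eq_in_imset => k kA.
by rewrite tpermD //; apply: contraTneq kA => <-.
Qed.

End Batches.

(** * Symmetrization *)

Section Swap.
Variables (I T : finType) (lo hi : I -> T).
Hypotheses (lo_inj : injective lo) (hi_inj : injective hi).
Hypothesis (lo_hi : forall i j, lo i != hi j).
Implicit Types e : {ffun I -> bool}.

Definition swap_fun e (t : T) : T :=
  if [pick i | (t == lo i) || (t == hi i)] is Some i then
    if e i then (if t == lo i then hi i else lo i) else t
  else t.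

Lemma swap_fun_lo e i : swap_fun e (lo i) = if e i then hi i else lo i.
Proof.
rewrite /swap_fun; case: pickP => [j|/(_ i)]; last by rewrite eqxx.
by rewrite (negPf (lo_hi i j)) orbF => /eqP/lo_inj <-; rewrite eqxx.
Qed.

Lemma swap_fun_hi e i : swap_fun e (hi i) = if e i then lo i else hi i.
Proof.
have hi_lo j k : (hi j == lo k) = false.
  by rewrite eq_sym; apply: negPf.
rewrite /swap_fun; case: pickP => [j|/(_ i)]; last by rewrite eqxx orbT.
by rewrite hi_lo => /eqP/hi_inj <-.
Qed.

Lemma swap_funK e : involutive (swap_fun e).
Proof.
move=> t; rewrite {2}/swap_fun; case: pickP => [i /orP[] /eqP->|none].
- by case ei: (e i); rewrite ?eqxx ?swap_fun_hi ?swap_fun_lo ei.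
- rewrite eq_sym (negPf (lo_hi _ _)).
  by case ei: (e i); rewrite ?swap_fun_hi ?swap_fun_lo ei.
- by rewrite /swap_fun; case: pickP => // i; rewrite none.
Qed.

Definition swap e : {perm T} := perm (can_inj (swap_funK e)).

End Swap.

Section Symmetrization.
Variables (R : realType) (d N b : nat) (x : 'I_N -> 'cV[R]_d).
Hypothesis x_le1 : forall i, norm2 (x i) <= 1.
Variable V : batch N b -> 'cV[R]_d.

(** Exchanging the [k]-th sampled point [s (lo k)] with its ghost [s (hi k)]
    for all [k] in a random set does not change the distribution of [s]. Once
    [s] is fixed, the differences carry independent signs and [V] is just a
    choice function of the signs, so contraction applies to the sampled points
    and to the ghosts, each with half of the penalty. *)
Lemma symmetrization (lo hi : 'I_b -> 'I_N) (A : batch N b) (c : R) :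
  injective lo -> injective hi -> (forall i j, lo i != hi j) -> 0 < c ->
  expect (fun s => \sum_k `|dot (V (perm_batch s A)) (x (s (lo k)))|
                 - \sum_k `|dot (V (perm_batch s A)) (x (s (hi k)))|
                 - 2 * c * dot (V (perm_batch s A)) (V (perm_batch s A)))
  <= b%:R / (2 * c).
Proof.
move=> lo_inj hi_inj lo_hi c0.
have perm_gt0 : (0 < #|{perm 'I_N}|)%N by apply/card_gt0P; exists 1%g.
have signs_gt0 : (0 < #|{: {ffun 'I_b -> bool}}|)%N.
  by rewrite card_ffun expn_gt0 card_bool.
set Phi := (X in expect X <= _).
pose sw := swap lo_inj hi_inj lo_hi.
rewrite -(expect_cst (expect _) signs_gt0).
rewrite (eq_expect (fun e => esym (expect_inj Phi (@mulgI _ (sw e))))).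
rewrite expect_exchange -[leRHS](expect_cst _ perm_gt0).
apply: le_expect => s.
pose v e := V (perm_batch (sw e * s)%g A).
have sqr_x : \sum_(k < b) 1 = b%:R :> R by rewrite sumr_const card_ord.
have half (y : 'I_b -> 'cV[R]_d) (h : R -> R) : (forall k, dot (y k) (y k) <= 1) ->
    (forall t u, `|h t - h u| <= `|t - u|) ->
    expect (fun e => \sum_k sgn R e k * h (dot (v e) (y k)) - c * dot (v e) (v e))
    <= b%:R / (4 * c).
  move=> y1 hL; apply: le_trans (rademacher_lipschitz _ _ c0 (fun=> hL)) _.
  by rewrite ler_wpM2r ?invr_ge0 ?mulr_ge0 ?(ltW c0) // -sqr_x ler_sum.
have xx i : dot (x i) (x i) <= 1.
  by rewrite -sqr_norm2 expr_le1 // norm2_ge0.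
have -> : b%:R / (2 * c) = b%:R / (4 * c) + b%:R / (4 * c) :> R.
  by field; rewrite gt_eqF.
have absN (t u : R) : `|- `|t| - - `|u| | <= `|t - u|.
  by rewrite -opprD normrN ler_dist_dist.
have abs (t u : R) : `| `|t| - `|u| | <= `|t - u| by apply: ler_dist_dist.
apply: le_trans _ (lerD (half (x \o s \o lo) _ (fun=> xx _) abs)
                        (half (x \o s \o hi) _ (fun=> xx _) absN)).
rewrite -expectD; apply: le_expect => e; rewrite /Phi -/(v e) /=.
set q := dot _ _; rewrite -sumrB.
rewrite (_ : 2 * c * q = c * q + c * q); last by ring.
rewrite addrACA -opprD -big_split /= lerD2r.
apply: ler_sum => k _; rewrite !permM !permE swap_fun_lo // swap_fun_hi //.
by rewrite /sgn; case: (e k); rewrite ?expr0 ?expr1; lra.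
Qed.

Let absdot (A : batch N b) i : R := `|dot (V A) (x i)|.

(** The first [b] places of a random permutation hold the batch and the next
    [b] places a ghost batch. On average the ghost batch sees [b / (N - b)]
    times the sum over the complement of the batch, which turns the bound of
    [symmetrization] into a comparison with the sum over all points. *)
Lemma batch_vs_population (k : R) : (b + b <= N)%N ->
  0 < k ->
  N%:R * expect (fun A : batch N b => \sum_(i in val A) absdot A i)
  <= b%:R * expect (fun A : batch N b => \sum_i absdot A i)
     + (N%:R - b%:R) * (k * expect (fun A : batch N b => dot (V A) (V A)) + b%:R / k).
Proof.
move=> bbN k0.
have bN : (b <= N)%N := leq_trans (leq_addr _ _) bbN.
pose lo (j : 'I_b) : 'I_N := widen_ord bN j.
have hi_lt (j : 'I_b) : (b + j < N)%N.
  by apply: leq_trans bbN; rewrite ltn_add2l.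
pose hi (j : 'I_b) : 'I_N := Ordinal (hi_lt j).
have lo_inj : injective lo by move=> i j /(congr1 val) /= ij; apply: val_inj.
have hi_inj : injective hi.
  by move=> i j /(congr1 val) /= /addnI ij; apply: val_inj.
have lo_hi i j : lo i != hi j.
  by apply/eqP => /(congr1 val) /= ij; have := ltn_ord i; rewrite ij -ltn_subRL subnn.
have A_card : #|lo @: [set: 'I_b]%SET| == b by rewrite card_imset // cardsT card_ord.
pose A : batch N b := exist _ (lo @: [set: 'I_b]%SET) A_card.
have hi_out j : hi j \notin val A.
  by apply/imsetP => -[i _ /eqP]; rewrite eq_sym; apply/negP.
have k2 : 0 < k / 2 by rewrite divr_gt0.
set S := expect (fun A : batch N b => \sum_(i in val A) _).
set P := expect (fun A : batch N b => \sum_i _).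
have := symmetrization A lo_inj hi_inj lo_hi k2.
rewrite !expectB !expectZ !expect_sum (_ : 2 * (k / 2) = k); last by field.
have -> : \sum_j expect (fun s => absdot (perm_batch s A) (s (lo j))) = S.
  rewrite /S (expect_batch A) -expect_sum; apply: eq_expect => s.
  rewrite sum_perm_batch big_imset /=; last by move=> ? ? _ _; apply: lo_inj.
  by apply: eq_bigl => j; rewrite inE.
rewrite -(expect_batch A (fun B => dot (V B) (V B))); set q := expect _.
pose H := \sum_j expect (fun s => absdot (perm_batch s A) (s (hi j))).
rewrite -/H => sym.
have Hout : (N%:R - b%:R) * H = b%:R * (P - S).
  rewrite -natrB // mulr_sumr.
  rewrite (eq_bigr (fun=> P - S)) ?sumr_const ?card_ord ?mulr_natl // => j _.
  rewrite expect_perm_outside // /P /S -expectB; apply: eq_expect => B.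
  rewrite (bigID (mem (val B)) predT) /= addrC addrK.
  by apply: eq_bigl => i; rewrite !inE.
have Nb0 : 0 <= N%:R - b%:R :> R by rewrite subr_ge0 ler_nat.
have := ler_wpM2l Nb0 sym; nra.
Qed.

End Symmetrization.

(** * Spectral norms of Gram matrices *)

Section SpectralNorm.
Variable R : realType.

Lemma norm2_mulmx_le_frobenius m n (M : 'M[R]_(m, n)) (v : 'cV[R]_n) :
  norm2 (M *m v) <= Num.sqrt (\sum_i \sum_j M i j ^+ 2) * norm2 v.
Proof.
have M0 : 0 <= \sum_i \sum_j M i j ^+ 2.
  by apply: sumr_ge0 => i _; apply: sumr_ge0 => j _; apply: sqr_ge0.
rewrite /norm2 -sqrtrM // ler_sqrt ?mulr_ge0 ?dot_ge0 // dotE mulr_suml.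
apply: ler_sum => i _.
have -> : \sum_j M i j ^+ 2 = dot (row i M)^T (row i M)^T.
  by rewrite dotE; apply: eq_bigr => j _; rewrite !mxE expr2.
have -> : (M *m v) i 0 = dot (row i M)^T v.
  by rewrite dotE mxE; apply: eq_bigr => j _; rewrite !mxE.
rewrite -!sqr_norm2 -exprMn -expr2 -[leLHS]real_normK ?num_real //.
by rewrite lerXn2r ?nnegrE ?mulr_ge0 ?norm2_ge0 // normr_dot_le.
Qed.

Lemma spectral_norm_le_frobenius m n (M : 'M[R]_(m, n)) :
  spectral_norm M <= Num.sqrt (\sum_i \sum_j M i j ^+ 2).
Proof.
apply: ge_sup => [|_ [v /= v1 <-]].
  by exists (norm2 (M *m 0)), 0 => //=; rewrite norm2_0.
apply: le_trans (norm2_mulmx_le_frobenius _ _) _.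
by rewrite ler_piMr // sqrtr_ge0.
Qed.

Lemma norm2_mulmx_le1 m n (M : 'M[R]_(m, n)) (v : 'cV[R]_n) :
  norm2 v <= 1 -> norm2 (M *m v) <= spectral_norm M.
Proof.
move=> v1; apply: ub_le_sup; last by exists v.
exists (Num.sqrt (\sum_i \sum_j M i j ^+ 2)) => _ [u /= u1 <-].
apply: le_trans (norm2_mulmx_le_frobenius _ _) _.
by rewrite ler_piMr // sqrtr_ge0.
Qed.

Lemma spectral_norm_ge0 m n (M : 'M[R]_(m, n)) : 0 <= spectral_norm M.
Proof.
by have := @norm2_mulmx_le1 _ _ M 0; rewrite mulmx0 !norm2_0; apply.
Qed.

Lemma norm2_mulmx_le m n (M : 'M[R]_(m, n)) (v : 'cV[R]_n) :
  norm2 (M *m v) <= spectral_norm M * norm2 v.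
Proof.
have [v0|v_neq0] := eqVneq (norm2 v) 0.
  by rewrite (norm2_eq0 v0) mulmx0 !norm2_0 mulr0.
have v_gt0 : 0 < norm2 v by rewrite lt_def v_neq0 norm2_ge0.
rewrite -ler_pdivrMr // mulrC -[X in X * _]gtr0_norm ?invr_gt0 //.
rewrite -norm2Z scalemxAr norm2_mulmx_le1 //.
by rewrite norm2Z gtr0_norm ?invr_gt0 // mulVf.
Qed.

Variables (d n : nat) (y : 'I_n -> 'cV[R]_d).

(** The squared norm is the quadratic form of the Gram matrix at [s]. *)
Lemma sqr_norm2_combination_le (s : 'I_n -> R) :
  dot (\sum_j s j *: y j) (\sum_j s j *: y j)
  <= spectral_norm (gram y) * \sum_j s j ^+ 2.
Proof.
pose v : 'cV[R]_n := \col_j s j.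
have -> : \sum_j s j ^+ 2 = norm2 v * norm2 v.
  by rewrite -dot_normalized dotE; apply: eq_bigr => j _; rewrite mxE expr2.
have -> : dot (\sum_j s j *: y j) (\sum_j s j *: y j) = dot (gram y *m v) v.
  rewrite dot_suml dotE; apply: eq_bigr => i _.
  rewrite dotZl dot_sumr !mxE mulrC; congr (_ * _).
  by apply: eq_bigr => j _; rewrite dotZr !mxE mulrC.
apply: le_trans (cauchy_schwarz _ _) _.
by rewrite mulrA ler_wpM2r ?norm2_ge0 // norm2_mulmx_le.
Qed.

(** Duality: the combination of the [y j] with the weights [dot v (y j)] has
    inner product [\sum_j dot v (y j) ^+ 2] with [v], and its norm is bounded by
    the preceding lemma. *)
Lemma sum_sqr_dot_le (v : 'cV[R]_d) :
  \sum_j dot v (y j) ^+ 2 <= spectral_norm (gram y) * dot v v.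
Proof.
set S := \sum_j _; pose s j := dot v (y j).
have S_ge0 : 0 <= S by apply: sumr_ge0 => j _; apply: sqr_ge0.
have [S0|S_gt0] := leP S 0.
  by rewrite (le_trans S0) // mulr_ge0 ?spectral_norm_ge0 ?dot_ge0.
have vS : dot v (\sum_j s j *: y j) = S.
  by rewrite dot_sumr; apply: eq_bigr => j _; rewrite dotZr -expr2.
have := cauchy_schwarz v (\sum_j s j *: y j); rewrite vS => CS.
rewrite -(ler_pM2l S_gt0) -expr2.
apply: (@le_trans _ _ ((norm2 v * norm2 (\sum_j s j *: y j)) ^+ 2)).
  by rewrite lerXn2r ?nnegrE ?mulr_ge0 ?norm2_ge0.
rewrite exprMn !sqr_norm2 (_ : S * _ = dot v v * (spectral_norm (gram y) * S)).
  by rewrite ler_wpM2l ?dot_ge0 // sqr_norm2_combination_le.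
by ring.
Qed.

Lemma spectral_norm_gram_le : (forall i, norm2 (y i) <= 1) ->
  spectral_norm (gram y) <= n%:R.
Proof.
move=> y1; apply: le_trans (spectral_norm_le_frobenius _) _.
rewrite -[leRHS]ger0_norm // -sqrtr_sqr ler_sqrt ?sqr_ge0 //.
have -> : n%:R ^+ 2 = \sum_(i < n) \sum_(j < n) 1 :> R.
  by rewrite !sumr_const card_ord expr2 mulr_natl.
apply: ler_sum => i _; apply: ler_sum => j _.
rewrite mxE -[leLHS]real_normK ?num_real // exprn_ile1 //.
by rewrite (le_trans (normr_dot_le _ _)) // mulr_ile1 ?norm2_ge0.
Qed.

End SpectralNorm.

(** * The second moment of the population *)

Section Population.
Variables (R : realType) (d N : nat) (x : 'I_N -> 'cV[R]_d).
Hypothesis N_gt0 : (0 < N)%N.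

Let N_pos : 0 < N%:R :> R. Proof. by rewrite ltr0n. Qed.

Lemma sum_abs_dot_le (v : 'cV[R]_d) :
  (\sum_i `|dot v (x i)|) ^+ 2 <= N%:R ^+ 2 * rho2 x * dot v v.
Proof.
have := sqr_expect_le (fun i => `|dot v (x i)|).
rewrite /expect card_ord expr_div_n ler_pdivrMr ?exprn_gt0 // => h.
apply: le_trans h _; rewrite /rho2.
rewrite (_ : _ * _ * dot v v = N%:R * (spectral_norm (gram x) * dot v v)).
  set S := \sum_i _; rewrite (_ : S / _ * _ = N%:R * S); last first.
    by field; rewrite gt_eqF.
  rewrite ler_wpM2l ?ler0n //.
  apply: le_trans _ (sum_sqr_dot_le x v).
  by apply: ler_sum => i _; rewrite real_normK ?num_real.
by field; rewrite gt_eqF.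
Qed.

Lemma rho2_ge0 : 0 <= rho2 x.
Proof. by rewrite divr_ge0 ?spectral_norm_ge0. Qed.

Lemma rho2_le1 : (forall i, norm2 (x i) <= 1) -> rho2 x <= 1.
Proof. by move=> x1; rewrite ler_pdivrMr // mul1r spectral_norm_gram_le. Qed.

End Population.

(** * Second moments of signed batch sums *)

Section SecondMoment.
Variables (R : realType) (d N b : nat) (x : 'I_N -> 'cV[R]_d).
Hypotheses (x_le1 : forall i, norm2 (x i) <= 1).
Hypotheses (b_gt0 : (0 < b)%N) (b_le_N : (b <= N)%N).
Implicit Types (s : batch N b -> 'I_N -> R) (kappa : R).

Definition batch_sum s (A : batch N b) : 'cV[R]_d :=
  \sum_(j in val A) s A j *: x j.

Definition unit_weights s : Prop :=
  forall (A : batch N b) j, j \in val A -> `|s A j| <= 1.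

Let N_gt0 : (0 < N)%N := leq_trans b_gt0 b_le_N.
Let b_pos : 0 < b%:R :> R. Proof. by rewrite ltr0n. Qed.
Let N_pos : 0 < N%:R :> R. Proof. by rewrite ltr0n. Qed.

Lemma principal_submx_gram (A : batch N b) :
  principal_submx (gram x) (val A)
  = gram (fun k : 'I_#|val A| => x (@enum_val _ (mem (val A)) k)).
Proof. by apply/matrixP => i j; rewrite !mxE. Qed.

Lemma batch_sum_le_spectral s (A : batch N b) : unit_weights s ->
  dot (batch_sum s A) (batch_sum s A)
  <= b%:R * spectral_norm (principal_submx (gram x) (val A)).
Proof.
move=> s1; rewrite principal_submx_gram /batch_sum big_enum_val /= mulrC.
apply: le_trans (sqr_norm2_combination_le _ _) _.
rewrite ler_wpM2l ?spectral_norm_ge0 //.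
have -> : b%:R = \sum_(k < #|val A|) 1 :> R.
  by rewrite sumr_const card_ord card_batch.
apply: ler_sum => k _.
by rewrite -[leLHS]real_normK ?num_real // exprn_ile1 // s1 // enum_valP.
Qed.

Let sgn_dot (v : 'cV[R]_d) (A : batch N b) i : R := Num.sg (dot v (x i)).

Lemma dot_batch_sum_sgn (v : 'cV[R]_d) A :
  dot v (batch_sum (sgn_dot v) A) = \sum_(j in val A) `|dot v (x j)|.
Proof.
by rewrite dot_sumr; apply: eq_bigr => j _; rewrite dotZr -normrEsg.
Qed.

Lemma sgn_dot_le1 v : unit_weights (sgn_dot v).
Proof. by move=> A j _; rewrite /sgn_dot normr_sg; case: eqP. Qed.

(** A batch sum weighted by the signs of [dot v (x j)] has inner product with
    [v] equal to the sum of the [`|dot v (x j)|], whose average over batches is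
    [b] times the average over the population. Second moments of batch sums
    hence control the Lipschitz constant of the average loss. *)
Lemma sqr_expect_dot_le kappa (v : 'cV[R]_d) :
  (forall s, unit_weights s ->
     expect (fun A => dot (batch_sum s A) (batch_sum s A)) <= kappa * b%:R ^+ 2) ->
  expect (fun i => `|dot v (x i)|) ^+ 2 <= kappa * dot v v.
Proof.
move=> mom; have := mom _ (sgn_dot_le1 v).
set V := batch_sum (sgn_dot v) => {}mom.
have := expect_batch_sum (fun i => `|dot v (x i)|) (batch_inhabited b_le_N).
set P := expect (fun i => _) => bP.
rewrite -(ler_pM2r (exprn_gt0 2 b_pos)) -exprMn (mulrC P) -bP.
apply: le_trans (sqr_expect_le _) _.
apply: (@le_trans _ _ (dot v v * expect (fun A => dot (V A) (V A)))).
  rewrite -expectZ; apply: le_expect => A.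
  rewrite -dot_batch_sum_sgn -[leLHS]real_normK ?num_real //.
  rewrite -2!sqr_norm2 -exprMn lerXn2r ?nnegrE ?mulr_ge0 ?norm2_ge0 //.
  exact: normr_dot_le.
by rewrite mulrAC mulrC ler_wpM2r ?dot_ge0.
Qed.

Lemma sqr_norm2_batch_sum_le s A : unit_weights s ->
  dot (batch_sum s A) (batch_sum s A)
  <= \sum_(j in val A) `|dot (batch_sum s A) (x j)|.
Proof.
move=> s1; set V := batch_sum s A; rewrite {2}/V dot_sumr.
apply: ler_sum => j jA; rewrite dotZr (le_trans (ler_norm _)) // normrM.
by rewrite ler_piMl ?s1.
Qed.

Lemma batch_sum_le_rho2 s A : unit_weights s ->
  dot (batch_sum s A) (batch_sum s A) <= N%:R ^+ 2 * rho2 x.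
Proof.
move=> s1; set V := batch_sum s A; set q := dot V V.
have q0 : 0 <= q := dot_ge0 V.
have [q_le0|q_gt0] := leP q 0.
  by rewrite (le_trans q_le0) // mulr_ge0 ?rho2_ge0 ?exprn_ge0.
rewrite -(ler_pM2r q_gt0) -expr2; apply: le_trans _ (sum_abs_dot_le x N_gt0 V).
rewrite lerXn2r ?nnegrE ?sumr_ge0 //.
apply: le_trans (sqr_norm2_batch_sum_le A s1) _.
rewrite [leRHS](bigID (mem (val A))) /= lerDl sumr_ge0 //.
Qed.

(** The constants [1/5] and [2/5] balance the two terms: the first coefficient
    is half of the second, and [(N - b) / N] can exceed
    [mean_spectral_bound - b * rho2 x] by half of [b * rho2 x]. *)
Lemma expect_batch_sum_symmetrized s : unit_weights s -> (b + b <= N)%N ->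
  expect (fun A => dot (batch_sum s A) (batch_sum s A))
  <= 25 / 8 * b%:R ^+ 2 * rho2 x + 25 / 4 * b%:R * ((N%:R - b%:R) / N%:R).
Proof.
move=> s1 bbN; set V := batch_sum s; set q := expect _.
have k_gt0 : 0 < 2 / 5 :> R by lra.
have := @batch_vs_population R d N b x x_le1 V (2 / 5) bbN k_gt0.
rewrite -/q; set S := expect _; set P := expect _ => main.
have qS : q <= S by apply: le_expect => A; apply: sqr_norm2_batch_sum_le.
have Pq : b%:R * P <= N%:R * (1 / 5 * q + 5 / 4 * (b%:R ^+ 2 * rho2 x)).
  rewrite -!expectZ -(expect_cst (5 / 4 * _) (batch_inhabited b_le_N)) -expectD.
  rewrite -expectZ; apply: le_expect => A.
  rewrite -ler_pdivrMl //; set F := \sum_i _.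
  rewrite (_ : 5 / 4 * _ = (b%:R ^+ 2 * rho2 x) / (4 * (1 / 5))); last by field.
  apply: le_amgm; [lra | | exact: dot_ge0 | ].
    by rewrite mulr_ge0 ?rho2_ge0 ?exprn_ge0.
  have := sum_abs_dot_le x N_gt0 (V A); rewrite -/F => FN.
  rewrite !exprMn exprVn ler_pdivrMl ?exprn_gt0 //.
  rewrite [leRHS](_ : _ = b%:R ^+ 2 * (N%:R ^+ 2 * rho2 x * dot (V A) (V A))).
    by rewrite ler_wpM2l ?exprn_ge0.
  by ring.
rewrite -(ler_pM2l N_pos).
rewrite (_ : N%:R * (_ + _) = 25 / 8 * N%:R * b%:R ^+ 2 * rho2 x
                            + 25 / 4 * b%:R * (N%:R - b%:R)); last first.
  by field; rewrite gt_eqF.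
have q_ge0 : 0 <= q by apply: expect_ge0 => A; apply: dot_ge0.
have := ler_wpM2l (ltW N_pos) qS.
have := mulr_ge0 (ltW b_pos) q_ge0.
nra.
Qed.

Lemma expect_batch_sum_spectral s : unit_weights s ->
  expect (fun A => dot (batch_sum s A) (batch_sum s A))
  <= b%:R * expect (fun A : batch N b =>
                      spectral_norm (principal_submx (gram x) (val A))).
Proof.
move=> s1; rewrite -expectZ; apply: le_expect => A.
exact: batch_sum_le_spectral.
Qed.

(** For weights that do not depend on the batch, [L ^ 2 / b] times this number
    bounds the second moment of a batch subgradient, by counting pairs. *)
Definition mean_spectral_bound : R :=
  1 + (b%:R - 1) * (N%:R * rho2 x - 1) / (N%:R - 1).

Lemma mean_spectral_boundE : (1 < b)%N ->
  mean_spectral_bound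
  = b%:R * rho2 x + (N%:R - b%:R) / (N%:R - 1) * (1 - rho2 x).
Proof.
move=> b_gt1; have N_gt1 : (1 : R) < N%:R by rewrite ltr1n (leq_trans b_gt1).
by rewrite /mean_spectral_bound; field; rewrite subr_eq0 gt_eqF.
Qed.

Let fraction_left : (1 < b)%N ->
  0 <= ((N%:R - b%:R) / (N%:R - 1) : R) <= 1.
Proof.
move=> b_gt1; have b1 : (1 : R) < b%:R by rewrite ltr1n.
have bN : b%:R <= N%:R :> R by rewrite ler_nat.
rewrite divr_ge0 ?ler_pdivrMr ?subr_gt0 ?subr_ge0 //; lra.
Qed.

Lemma rho2_le_mean_spectral_bound : b%:R * rho2 x <= mean_spectral_bound.
Proof.
have [b_gt1|b_le1] := ltnP 1 b.
  rewrite mean_spectral_boundE // lerDl mulr_ge0 //.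
    by case/andP: (fraction_left b_gt1).
  by rewrite subr_ge0 (rho2_le1 N_gt0).
have b1 : b = 1%N by apply/eqP; rewrite eqn_leq b_le1.
by rewrite /mean_spectral_bound b1 subrr !mul0r addr0 mul1r (rho2_le1 N_gt0).
Qed.

(** The weights may depend on the batch. If [N < 2 * b], the sum over the batch
    is bounded by the sum over the whole population at the price of a factor
    [4]; if [2 * b <= N], there is room for a ghost batch. *)
Lemma expect_batch_sum_mean s : unit_weights s ->
  expect (fun A => dot (batch_sum s A) (batch_sum s A))
  <= 25 / 4 * (b%:R * mean_spectral_bound).
Proof.
move=> s1; have rho0 := rho2_ge0 x; have rho_le := rho2_le_mean_spectral_bound.
have K0 : 0 <= mean_spectral_bound.
  by apply: le_trans rho_le; rewrite mulr_ge0 ?(ltW b_pos).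
have [b_gt1|b_le1] := ltnP 1 b; last first.
  have b1 : b%:R = 1 :> R by apply/eqP; rewrite pnatr_eq1 eqn_leq b_le1.
  have -> : mean_spectral_bound = 1 by rewrite /mean_spectral_bound b1 subrr !mul0r addr0.
  apply: le_trans (expect_batch_sum_spectral s1) _; rewrite [leRHS]mulrCA.
  rewrite ler_wpM2l ?(ltW b_pos) //; apply: (@le_trans _ _ 1); last by lra.
  rewrite -(expect_cst 1 (batch_inhabited b_le_N)); apply: le_expect => A.
  by rewrite principal_submx_gram (le_trans (spectral_norm_gram_le _)) // card_batch b1.
have [bbN|Nbb] := leqP (b + b) N; last first.
  have N2b : N%:R <= 2 * b%:R :> R by rewrite -natrM ler_nat mul2n -addnn ltnW.
  apply: (@le_trans _ _ (N%:R ^+ 2 * rho2 x)).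
    rewrite -(expect_cst (N%:R ^+ 2 * rho2 x) (batch_inhabited b_le_N)).
    by apply: le_expect => A; apply: batch_sum_le_rho2.
  apply: (@le_trans _ _ (4 * b%:R * (b%:R * rho2 x))).
    rewrite (_ : 4 * _ * _ = (2 * b%:R) ^+ 2 * rho2 x); last by ring.
    by rewrite ler_wpM2r // lerXn2r ?nnegrE // mulr_ge0 ?(ltW b_pos).
  have := ler_wpM2l (ltW b_pos) rho_le; have := mulr_ge0 (ltW b_pos) K0.
  by lra.
apply: le_trans (expect_batch_sum_symmetrized s1 bbN) _.
rewrite -subr_ge0 (_ : _ - _ =
    25 / 4 * b%:R * (mean_spectral_bound - b%:R * rho2 x / 2 - (N%:R - b%:R) / N%:R)).
  rewrite mulr_ge0 ?mulr_ge0 ?(ltW b_pos) // mean_spectral_boundE //.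
  have b2 : 2 <= b%:R :> R by rewrite ler_nat.
  have bN : b%:R <= N%:R :> R by rewrite ler_nat.
  have : (N%:R - b%:R) / N%:R <= (N%:R - b%:R) / (N%:R - 1) :> R.
    by rewrite ler_wpM2l ?subr_ge0 // lef_pV2 ?posrE; lra.
  have /andP[] := fraction_left b_gt1.
  set gamma := (N%:R - b%:R) / (N%:R - 1); set delta := _ / N%:R.
  by move=> g0 g1 dg; nra.
by field; rewrite gt_eqF.
Qed.

End SecondMoment.

(** * The regularized objective *)

Section Objective.
Variables (R : realType) (d N : nat) (x : 'I_N -> 'cV[R]_d).
Variables (l : R -> R) (L mu : R).
Hypotheses (L_gt0 : 0 < L) (mu_gt0 : 0 < mu).
Hypothesis l_convex : convex_function [set: R^o] (l : R^o -> R^o).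
Hypothesis l_lipschitz : L.-lipschitz (l : R^o -> R^o).
Implicit Types u v w : 'cV[R]_d.

Lemma lipschitz_diff_le y z : l y - l z <= L * `|y - z|.
Proof.
apply: le_trans (ler_norm _) _.
by have := @l_lipschitz (y, z); apply.
Qed.

Lemma convex_segment t y z : 0 <= t <= 1 ->
  l (t * y + (1 - t) * z) <= t * l y + (1 - t) * l z.
Proof.
case/andP => t0 t1.
have := l_convex (Itv01 t0 t1) (in_setT (y : R^o)) (in_setT (z : R^o)).
by rewrite !convRE.
Qed.

Lemma subdifferential_le y s : subdifferential l y s -> `|s| <= L.
Proof.
move=> sy; rewrite ler_norml lerNl.
have := sy (y + 1); have := lipschitz_diff_le (y + 1) y.
have := sy (y - 1); have := lipschitz_diff_le (y - 1) y.
rewrite !(addrC y) !addrK normrN normr1; lra.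
Qed.

Definition mean_loss w : R := expect (fun i => l (dot w (x i))).

Lemma objectiveE w : objective x l mu w = mean_loss w + mu / 2 * dot w w.
Proof. by rewrite /objective /mean_loss /expect card_ord sqr_norm2. Qed.

Lemma mean_loss_convex t u v : 0 <= t <= 1 ->
  mean_loss (t *: u + (1 - t) *: v) <= t * mean_loss u + (1 - t) * mean_loss v.
Proof.
move=> t01; rewrite /mean_loss -!expectZ -expectD; apply: le_expect => i.
by rewrite dotDl !dotZl convex_segment.
Qed.

Lemma sqnorm_convex t u v : 0 <= t <= 1 ->
  dot (t *: u + (1 - t) *: v) (t *: u + (1 - t) *: v)
  <= t * dot u u + (1 - t) * dot v v.
Proof.
case/andP => t0 t1; rewrite -subr_ge0.
rewrite (_ : _ - _ = t * (1 - t) * dot (u - v) (u - v)).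
  by rewrite !mulr_ge0 ?dot_ge0 ?subr_ge0.
rewrite !(dotBl, dotBr, dotDl, dotDr, dotZl, dotZr) (dotC v u); ring.
Qed.

Lemma objective_convex t u v : 0 <= t <= 1 ->
  objective x l mu (t *: u + (1 - t) *: v)
  <= t * objective x l mu u + (1 - t) * objective x l mu v.
Proof.
move=> t01; rewrite !objectiveE !mulrDr addrACA.
apply: lerD; first exact: mean_loss_convex.
rewrite (mulrCA t) (mulrCA (1 - t)) -mulrDr ler_wpM2l ?divr_ge0 ?(ltW mu_gt0) //.
exact: sqnorm_convex.
Qed.

Variable kappa : R.
Hypothesis kappa_ge0 : 0 <= kappa.
Hypothesis mean_abs_dot : forall v,
  expect (fun i => `|dot v (x i)|) ^+ 2 <= kappa * dot v v.

(** A Lipschitz constant of the average loss. *)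
Definition loss_slope : R := L * Num.sqrt kappa.

Lemma loss_slope_ge0 : 0 <= loss_slope.
Proof. by rewrite mulr_ge0 ?sqrtr_ge0 // ltW. Qed.

Lemma mean_abs_dot_le v :
  L * expect (fun i => `|dot v (x i)|) <= loss_slope * norm2 v.
Proof.
rewrite -mulrA ler_wpM2l ?(ltW L_gt0) //.
have P_ge0 : 0 <= expect (fun i => `|dot v (x i)|) by apply: expect_ge0.
rewrite -(@ler_pXn2r _ 2) ?nnegrE //; last first.
  by rewrite mulr_ge0 ?sqrtr_ge0 ?norm2_ge0.
by rewrite [leRHS]exprMn sqr_sqrtr // sqr_norm2.
Qed.

Lemma mean_loss_lipschitz u v :
  mean_loss u - mean_loss v <= loss_slope * norm2 (u - v).
Proof.
apply: le_trans (mean_abs_dot_le _); rewrite /mean_loss -expectB -expectZ.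
by apply: le_expect => i; rewrite dotBl lipschitz_diff_le.
Qed.

Lemma objective_scale_le c u : 1 <= c ->
  objective x l mu (c *: u) - objective x l mu u
  <= (c - 1) * (loss_slope * norm2 u) + mu / 2 * (c ^+ 2 - 1) * dot u u.
Proof.
move=> c1; rewrite !objectiveE dotZl dotZr.
have := mean_loss_lipschitz (c *: u) u.
rewrite (_ : c *: u - u = (c - 1) *: u); last by rewrite scalerBl scale1r.
rewrite norm2Z ger0_norm ?subr_ge0 //.
move=> h; have : mu / 2 * (c * (c * dot u u)) - mu / 2 * dot u u
  = mu / 2 * (c ^+ 2 - 1) * dot u u by ring.
lra.
Qed.

Variable wstar : 'cV[R]_d.
Hypothesis wstar_min : forall v, objective x l mu wstar <= objective x l mu v.

(** Compare [wstar] with the points of the segment from [wstar] to [w]: the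
    loss is convex along it, and the quadratic term is of second order near
    [wstar]. *)
Lemma wstar_optimality w :
  0 <= mean_loss w - mean_loss wstar + mu * dot wstar (w - wstar).
Proof.
set a := _ + _; pose c := mu / 2 * dot (w - wstar) (w - wstar).
have c_ge0 : 0 <= c by rewrite mulr_ge0 ?dot_ge0 // divr_ge0 // ltW.
have main t : 0 < t <= 1 -> 0 <= a + t * c.
  case/andP => t0 t1; have t01 : 0 <= t <= 1 by rewrite (ltW t0).
  have := wstar_min (t *: w + (1 - t) *: wstar).
  have := mean_loss_convex w wstar t01.
  rewrite !objectiveE -(pmulr_rge0 _ t0) => h1 h2.
  have -> : t * (a + t * c) = t * mean_loss w + (1 - t) * mean_loss wstar
      + mu / 2 * dot (t *: w + (1 - t) *: wstar) (t *: w + (1 - t) *: wstar)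
      - (mean_loss wstar + mu / 2 * dot wstar wstar).
    rewrite /a /c !(dotBl, dotBr, dotDl, dotDr, dotZl, dotZr) (dotC w wstar).
    by field.
  lra.
have [//|a_lt0] := leP 0 a.
(* A negative [a] would dominate [t * c] at this value of [t]. *)
have ca : 0 < 2 * (c - a) by lra.
have /main : 0 < - a / (2 * (c - a)) <= 1.
  by rewrite divr_gt0 ?oppr_gt0 //= ler_pdivrMr // mul1r; lra.
have -> : a + - a / (2 * (c - a)) * c = a * (c - 2 * a) / (2 * (c - a)).
  by field; lra.
by rewrite pmulr_lge0 ?invr_gt0 // nmulr_rge0 //; lra.
Qed.

Lemma norm2_wstar_le : mu * norm2 wstar <= loss_slope.
Proof.
have := norm2_ge0 wstar; rewrite le_eqVlt => /orP[/eqP<-|n_gt0].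
  by rewrite mulr0 loss_slope_ge0.
have := wstar_optimality 0; have := mean_loss_lipschitz 0 wstar.
rewrite !sub0r norm2N dotNr -sqr_norm2 => h1 h2.
by rewrite -(ler_pM2r n_gt0); nra.
Qed.

(** The gap at [0] is at most [loss_slope ^+ 2 / (2 * mu)], and the objective
    grows from there at most as its Lipschitz and quadratic parts allow. *)
Lemma objective_gap_le v :
  objective x l mu v - objective x l mu wstar
  <= loss_slope * norm2 v + mu / 2 * dot v v + loss_slope ^+ 2 / (2 * mu).
Proof.
have := mean_loss_lipschitz v 0; have := mean_loss_lipschitz 0 wstar.
rewrite subr0 sub0r norm2N !objectiveE.
rewrite -(sqr_norm2 wstar) => h1 h2.
have : loss_slope * norm2 wstar <=
    mu / 2 * norm2 wstar ^+ 2 + loss_slope ^+ 2 / (4 * (mu / 2)).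
  apply: le_amgm; rewrite ?sqr_ge0 ?divr_gt0 //.
  by rewrite exprMn.
rewrite (_ : 4 * (mu / 2) = 2 * mu); last by field.
lra.
Qed.

End Objective.

(** * Averages of convex functions *)

Lemma jensen_seq (R : realType) (V : lmodType R) (f : V -> R) :
  (forall t u v, 0 <= t <= 1 ->
     f (t *: u + (1 - t) *: v) <= t * f u + (1 - t) * f v) ->
  forall (I : Type) (r : seq I) (w : I -> V), (0 < size r)%N ->
  f ((size r)%:R^-1 *: \sum_(i <- r) w i)
  <= (size r)%:R^-1 * \sum_(i <- r) f (w i).
Proof.
move=> f_convex I r w; elim: r => // a [|b r] IH _.
  by rewrite !big_seq1 invr1 scale1r mul1r.
have := IH isT; set n := size (b :: r); rewrite -/n => {}IH.
rewrite [size _]/= -/n !(big_cons _ _ a).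
set S := \sum_(i <- _) _ in IH *; set F := \sum_(i <- _) _ in IH *.
have n_gt0 : 0 < n%:R :> R by rewrite ltr0n.
have n1 : n.+1%:R = 1 + n%:R :> R by rewrite -natr1 addrC.
have t01 : 0 <= (n.+1%:R^-1 : R) <= 1.
  by rewrite invr_ge0 ler0n /= invf_le1 ?n1 ?lerDl ?ltW // addr_gt0.
have tn : (1 - n.+1%:R^-1) * n%:R^-1 = n.+1%:R^-1 :> R.
  by rewrite n1; field; rewrite !gt_eqF // addr_gt0.
have -> : n.+1%:R^-1 *: (w a + S)
          = n.+1%:R^-1 *: w a + (1 - n.+1%:R^-1) *: (n%:R^-1 *: S).
  by rewrite scalerA tn scalerDr.
apply: le_trans (f_convex _ _ _ t01) _.
rewrite mulrDr lerD2l -[in leRHS]tn -mulrA ler_wpM2l //.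
by rewrite subr_ge0; case/andP: t01.
Qed.

(** * The scalar recursion *)

Section Recursion.
Variables (R : realFieldType) (Delta gap : nat -> R) (M c : R) (T : nat).
Hypotheses (Delta_ge0 : forall n, 0 <= Delta n) (gap_ge0 : forall n, 0 <= gap n).
Hypotheses (M_ge0 : 0 <= M) (c_gt0 : 0 < c).
Hypothesis step : forall n, (n < T)%N ->
  n.+1%:R ^+ 2 * Delta n.+1 <= n%:R ^+ 2 * Delta n - c * n%:R * gap n + M.

Lemma recursion_rate n : (n <= T)%N -> n%:R * Delta n <= M.
Proof.
have main : (n <= T)%N -> n%:R ^+ 2 * Delta n <= n%:R * M.
  elim: n => [_|n IH nT]; first by rewrite expr0n mul0r mul0r.
  apply: le_trans (step nT) _; rewrite -natr1.
  have := IH (ltnW nT); have : 0 <= c * n%:R * gap n.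
    by rewrite !mulr_ge0 ?(ltW c_gt0).
  lra.
case: n main => [_ _|n main nT]; first by rewrite mul0r.
by rewrite -(@ler_pM2l _ n.+1%:R) ?ltr0n // mulrA -expr2 main.
Qed.

(** Dividing the recursion by [n] makes it telescope, since
    [(n + 1) ^ 2 / n >= n + 2]; the spare [Delta n] is what the quadratic part
    of the objective needs. *)
Lemma recursion_telescope n : (0 < n)%N -> (n < T)%N ->
  c * gap n + Delta n
  <= n.+1%:R * Delta n - n.+2%:R * Delta n.+1 + M / n%:R.
Proof.
move=> n_gt0 nT; have n_pos : 0 < n%:R :> R by rewrite ltr0n.
rewrite -(ler_pM2l n_pos) -!(natr1 n.+1) -!natr1 -subr_ge0.
have := step nT; rewrite -natr1.
have := Delta_ge0 n.+1.
rewrite (_ : n%:R * (_ + M / n%:R) =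
  n%:R * ((n%:R + 1) * Delta n - (n%:R + 1 + 1) * Delta n.+1) + M).
  by nra.
by field; rewrite gt_eqF.
Qed.

Lemma recursion_sum m : (0 < m)%N -> (m <= T)%N ->
  \sum_(m <= n < T) (c * gap n + Delta n)
  <= M * (m.+1%:R / m%:R + \sum_(m <= n < T) n%:R^-1).
Proof.
move=> m_gt0 mT; have m_pos : 0 < m%:R :> R by rewrite ltr0n.
apply: (@le_trans _ _ (\sum_(m <= n < T)
   ((- (n.+2%:R * Delta n.+1) - - (n.+1%:R * Delta n)) + M / n%:R))).
  rewrite !big_nat; apply: ler_sum => n /andP[mn nT].
  rewrite opprK (addrC (- _)); apply: recursion_telescope => //.
  exact: leq_trans mn.
rewrite big_split /= -mulr_sumr telescope_sumr // opprK mulrDr lerD2r.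
have h1 := recursion_rate mT.
have h2 : 0 <= T.+1%:R * Delta T by rewrite mulr_ge0.
rewrite -(ler_pM2l m_pos) (_ : m%:R * (M * _) = m.+1%:R * M); last first.
  by field; rewrite gt_eqF.
have : m.+1%:R * (m%:R * Delta m) <= m.+1%:R * M by rewrite ler_wpM2l.
have := mulr_ge0 (ltW m_pos) h2; lra.
Qed.

End Recursion.

Lemma sum_inv_double_le1 (R : realFieldType) m :
  \sum_(m.+1 <= n < m.+1.*2) (n%:R^-1 : R) <= 1.
Proof.
apply: (@le_trans _ _ (\sum_(m.+1 <= n < m.+1.*2) m.+1%:R^-1)).
  rewrite !big_nat; apply: ler_sum => n /andP[mn _].
  by rewrite lef_pV2 ?posrE ?ltr0n ?ler_nat // (leq_trans _ mn).
by rewrite sumr_const_nat -addnn addnK -[leLHS]mulr_natl mulfV ?pnatr_eq0.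
Qed.

(** By convexity of the inverse, the mean of the terms is at most the mean of
    the first and the last one. *)
Lemma sum_inv_double_succ_le (R : realFieldType) m :
  \sum_(m.+1 <= n < m.+1.*2.+1) (n%:R^-1 : R) <= 3 / 4 * (m.+2%:R / m.+1%:R).
Proof.
elim: m => [|m IH].
  by rewrite big_nat_recr //= big_nat1 !invr1 (_ : 1.*2 = 2%N) //; lra.
have m_ge0 : 0 <= m%:R :> R by [].
have lt1 : (m.+1 < m.+1.*2.+1)%N by rewrite ltnS -addnn leq_addr.
move: IH; rewrite [in leLHS]big_ltn //.
rewrite [m.+2.*2]doubleS [in X in _ -> X]big_nat_recr /=; last by rewrite ltnW.
rewrite [in X in _ -> X]big_nat_recr /=; last by [].
set S := \sum_(_ <= _ < _) _.
have -> : m.+1.*2.+1%:R = 2 * m%:R + 3 :> R.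
  by rewrite -addn1 -muln2 natrD natrM -natr1; ring.
have -> : m.+1.*2.+2%:R = 2 * (m%:R + 2) :> R.
  by rewrite -addn2 -muln2 natrD natrM -natr1; ring.
rewrite -[m.+3%:R]natr1 -[m.+2%:R]natr1 -[m.+1%:R]natr1 => IH.
have : 0 <= (4 * (m%:R + 1) * (m%:R + 2) * (2 * m%:R + 3))^-1 :> R.
  by rewrite invr_ge0 !mulr_ge0 // addr_ge0 // mulr_ge0.
have -> : (4 * (m%:R + 1) * (m%:R + 2) * (2 * m%:R + 3))^-1
   = 3 / 4 * ((m%:R + 1 + 1 + 1) / (m%:R + 1 + 1))
     - 3 / 4 * ((m%:R + 1 + 1) / (m%:R + 1)) + (m%:R + 1)^-1
     - (2 * m%:R + 3)^-1 - (2 * (m%:R + 2))^-1 :> R.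
  by field; rewrite !gt_eqF //; lra.
by lra.
Qed.

(** * One step of the method *)

Section OneStep.
Variables (R : realType) (d N b : nat) (x : 'I_N -> 'cV[R]_d).
Variables (l : R -> R) (L kappa : R).
Hypotheses (b_gt0 : (0 < b)%N) (b_le_N : (b <= N)%N) (L_gt0 : 0 < L).
Hypothesis l_lipschitz : L.-lipschitz (l : R^o -> R^o).
Hypothesis kappa_ge0 : 0 <= kappa.
Hypothesis mean_abs_dot : forall v,
  expect (fun i => `|dot v (x i)|) ^+ 2 <= kappa * dot v v.
Hypothesis second_moment : forall s : batch N b -> 'I_N -> R, unit_weights s ->
  expect (fun A => dot (batch_sum x s A) (batch_sum x s A))
  <= 25 / 4 * kappa * b%:R ^+ 2.
Variables (w : 'cV[R]_d) (g : batch N b -> 'cV[R]_d).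
Hypothesis g_subgradient : forall A, batch_subgradients x l (val A) w (g A).

Let D := loss_slope L kappa.
Let b_pos : 0 < b%:R :> R. Proof. by rewrite ltr0n. Qed.

Lemma batch_subgradient_weights : exists2 s : batch N b -> 'I_N -> R,
  (forall (A : batch N b) j, j \in val A -> subdifferential l (dot w (x j)) (s A j)) &
  forall A, g A = b%:R^-1 *: batch_sum x s A.
Proof.
have /choice[s hs] : forall A : batch N b, exists s : 'I_N -> R,
    (forall j, j \in val A -> subdifferential l (dot w (x j)) (s j)) /\
    g A = b%:R^-1 *: \sum_(j in val A) s j *: x j.
  by move=> A; have [s s1 ->] := g_subgradient A; exists s; rewrite card_batch.
by exists s => A; have [] := hs A.
Qed.

(** The weights may depend on the batch, but whatever the batch each of them
    is a subgradient of the loss of its own point; only these linear lower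
    bounds are averaged. *)
Lemma expect_subgradient_ge v :
  mean_loss x l w - mean_loss x l v <= expect (fun A => dot (g A) (w - v)).
Proof.
have [s s_sub gE] := batch_subgradient_weights.
rewrite /mean_loss -expectB -(ler_pM2l b_pos).
rewrite -(expect_batch_sum _ (batch_inhabited b_le_N)) -expectZ.
apply: le_expect => A; rewrite gE dotZl mulVKf ?gt_eqF // dot_suml.
apply: ler_sum => j jA; rewrite dotZl dotBr !(dotC (x j)).
by have := s_sub A j jA (dot v (x j)); lra.
Qed.

Lemma expect_subgradient_dot_le v :
  expect (fun A => dot (g A) v) <= D * norm2 v.
Proof.
have [s s_sub gE] := batch_subgradient_weights.
apply: le_trans (mean_abs_dot_le L_gt0 kappa_ge0 mean_abs_dot v).
rewrite -expectZ -(ler_pM2l b_pos).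
rewrite -(expect_batch_sum _ (batch_inhabited b_le_N)) -expectZ.
apply: le_expect => A; rewrite gE dotZl mulVKf ?gt_eqF // dot_suml.
apply: ler_sum => j jA; rewrite dotZl (dotC (x j)).
rewrite (le_trans (ler_norm _)) // normrM ler_wpM2r //.
by have := subdifferential_le l_lipschitz (s_sub A j jA).
Qed.

Lemma expect_sqr_subgradient_le :
  expect (fun A => dot (g A) (g A)) <= 25 / 4 * D ^+ 2.
Proof.
have [s s_sub gE] := batch_subgradient_weights.
pose s1 A j := s A j / L.
have s1_unit : unit_weights s1.
  move=> A j jA; rewrite normrM normfV (gtr0_norm L_gt0) ler_pdivrMr // mul1r.
  by have := subdifferential_le l_lipschitz (s_sub A j jA).
rewrite (eq_expect (Y := fun A =>
    (L / b%:R) ^+ 2 * dot (batch_sum x s1 A) (batch_sum x s1 A))).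
  rewrite expectZ (_ : 25 / 4 * D ^+ 2 =
      (L / b%:R) ^+ 2 * (25 / 4 * kappa * b%:R ^+ 2)).
    by rewrite ler_wpM2l ?sqr_ge0 ?second_moment.
  rewrite /D /loss_slope exprMn sqr_sqrtr //.
  by field; rewrite gt_eqF.
move=> A; have -> : g A = (L / b%:R) *: batch_sum x s1 A.
  rewrite gE /batch_sum !scaler_sumr; apply: eq_bigr => j _.
  by rewrite !scalerA; congr (_ *: _); rewrite /s1; field; rewrite !gt_eqF.
by rewrite dotZl dotZr mulrA -expr2.
Qed.

End OneStep.

(** * The run of the method *)

Section Resampling.
Variables (R : realType) (N b T : nat).

Definition redraw (om : draws N b T) (i : 'I_T) (A : batch N b) : draws N b T :=
  [ffun j => if j == i then A else om j].

(** The draws are independent: exchanging the [i]-th batch with a fresh one is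
    an involution of the pairs of a draw sequence and a batch. *)
Lemma expect_redraw (X : draws N b T -> R) i : (b <= N)%N ->
  expect X = expect (fun om => expect (fun A => X (redraw om i A))).
Proof.
move=> bN; have batch_pos : #|{: batch N b}|%:R != 0 :> R.
  by rewrite pnatr_eq0 -lt0n batch_inhabited.
pose h (p : draws N b T * batch N b) := (redraw p.1 i p.2, p.1 i).
have hK : involutive h.
  move=> [om A]; congr (_, _) => /=; last by rewrite ffunE eqxx.
  by apply/ffunP => j; rewrite !ffunE; case: eqP => [->|].
rewrite /expect -mulr_suml pair_bigA /=.
have := reindex_inj (can_inj hK) => /(_ _ _ _ xpredT (fun p => X p.1)) /= <-.
rewrite -(pair_bigA _ (fun om A => X om)) /=.
under [in RHS]eq_bigr => om _ do rewrite sumr_const -[_ *+ _]mulr_natr.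
by rewrite -mulr_suml mulfK.
Qed.

End Resampling.

Section Run.
Variables (R : realType) (d N b T : nat) (x : 'I_N -> 'cV[R]_d).
Variables (l : R -> R) (L mu kappa : R).
Variables (wstar : 'cV[R]_d) (w : draws N b T -> nat -> 'cV[R]_d).
Variable g : draws N b T -> 'I_T -> 'cV[R]_d.
Hypotheses (b_gt0 : (0 < b)%N) (b_le_N : (b <= N)%N) (L_gt0 : 0 < L).
Hypothesis mu_gt0 : 0 < mu.
Hypothesis l_convex : convex_function [set: R^o] (l : R^o -> R^o).
Hypothesis l_lipschitz : L.-lipschitz (l : R^o -> R^o).
Hypothesis wstar_min : forall v, objective x l mu wstar <= objective x l mu v.
Hypothesis run : minibatch_run x l mu w g.
Hypothesis kappa_ge0 : 0 <= kappa.
Hypothesis mean_abs_dot : forall v,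
  expect (fun i => `|dot v (x i)|) ^+ 2 <= kappa * dot v v.
Hypothesis second_moment : forall s : batch N b -> 'I_N -> R, unit_weights s ->
  expect (fun A => dot (batch_sum x s A) (batch_sum x s A))
  <= 25 / 4 * kappa * b%:R ^+ 2.

Let D := loss_slope L kappa.

Let draws_gt0 : (0 < #|{: draws N b T}|)%N.
Proof. by rewrite card_ffun expn_gt0 batch_inhabited. Qed.

Lemma iterate_adapted n : (n <= T)%N -> forall om om' : draws N b T,
  (forall j : 'I_T, (j < n)%N -> om j = om' j) -> w om n.+1 = w om' n.+1.
Proof.
case: run => w1 _ w_step g_adapted; elim: n => [_|n IH nT] om om' eq_om.
  by rewrite !w1.
have /= stepE o := w_step o (Ordinal nT).
rewrite !stepE (IH (ltnW nT) om om') => [|j jn]; last exact/eq_om/ltnW.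
by rewrite (g_adapted om om' (Ordinal nT)).
Qed.

Lemma iterate_redraw om (i : 'I_T) A : w (redraw om i A) i.+1 = w om i.+1.
Proof.
apply: iterate_adapted (ltnW (ltn_ord i)) _ _ _ => j ji.
by rewrite ffunE -val_eqE ltn_eqF.
Qed.

Lemma redraw_subgradient om (i : 'I_T) (A : batch N b) :
  batch_subgradients x l (val A) (w om i.+1) (g (redraw om i A) i).
Proof.
case: run => _ /(_ (redraw om i A) i) + _ _.
by rewrite iterate_redraw ffunE eqxx.
Qed.

Lemma expect_run_subgradient_ge (i : 'I_T) v :
  expect (fun om => mean_loss x l (w om i.+1)) - mean_loss x l v
  <= expect (fun om => dot (g om i) (w om i.+1 - v)).
Proof.
rewrite (expect_redraw _ i b_le_N) -[X in _ - X <= _](expect_cst _ draws_gt0).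
rewrite -expectB [leRHS](expect_redraw _ i b_le_N); apply: le_expect => om.
rewrite (eq_expect (Y := fun=> mean_loss x l (w om i.+1))); last first.
  by move=> A; rewrite iterate_redraw.
rewrite expect_cst ?batch_inhabited //.
apply: le_trans (expect_subgradient_ge b_gt0 b_le_N (redraw_subgradient om i) v) _.
by apply: le_expect => A; rewrite iterate_redraw.
Qed.

Lemma expect_run_subgradient_dot_le i v :
  expect (fun om => dot (g om i) v) <= D * norm2 v.
Proof.
rewrite (expect_redraw _ i b_le_N) -[leRHS](expect_cst _ draws_gt0).
by apply: le_expect => om; apply: expect_subgradient_dot_le (redraw_subgradient om i) v.
Qed.

Lemma expect_run_sqr_subgradient_le i :
  expect (fun om => dot (g om i) (g om i)) <= 25 / 4 * D ^+ 2.
Proof.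
rewrite (expect_redraw _ i b_le_N) -[leRHS](expect_cst _ draws_gt0).
by apply: le_expect => om; apply: expect_sqr_subgradient_le (redraw_subgradient om i).
Qed.

Definition mean_sqdist n : R :=
  expect (fun om => dot (w om n.+1 - wstar) (w om n.+1 - wstar)).

(** The gap of the objective without its quadratic part. *)
Definition mean_linear_gap n : R := expect (fun om =>
  mean_loss x l (w om n.+1) - mean_loss x l wstar
  + mu * dot wstar (w om n.+1 - wstar)).

Lemma mean_sqdist_ge0 n : 0 <= mean_sqdist n.
Proof. by apply: expect_ge0 => om; apply: dot_ge0. Qed.

Lemma mean_linear_gap_ge0 n : 0 <= mean_linear_gap n.
Proof. by apply: expect_ge0 => om; apply: wstar_optimality. Qed.

Lemma expect_objective_gapE n :
  expect (fun om => objective x l mu (w om n.+1)) - objective x l mu wstar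
  = mean_linear_gap n + mu / 2 * mean_sqdist n.
Proof.
rewrite -[X in _ - X](expect_cst _ draws_gt0) -expectB -expectZ -expectD.
apply: eq_expect => om; rewrite !objectiveE.
by rewrite !(dotBl, dotBr) (dotC (w om _) wstar); field.
Qed.

(** The vector [mu *: wstar] is counted with the subgradient, as minus a
    subgradient of the average loss at [wstar]. The distance then contracts by
    [i / (i + 1)], so that its square decreases like [1 / i]. *)
Lemma sqdist_step om (i : 'I_T) :
  i.+1%:R ^+ 2 * dot (w om i.+2 - wstar) (w om i.+2 - wstar)
  = i%:R ^+ 2 * dot (w om i.+1 - wstar) (w om i.+1 - wstar)
    - 2 * i%:R / mu * (dot (g om i) (w om i.+1 - wstar)
                       + mu * dot wstar (w om i.+1 - wstar))
    + mu ^- 2 * (dot (g om i) (g om i) + 2 * mu * dot (g om i) wstar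
                 + mu ^+ 2 * dot wstar wstar).
Proof.
case: run => _ _ w_step _; set e := w om i.+1 - wstar.
have mu_neq0 : mu != 0 by rewrite gt_eqF.
have E : i.+1%:R *: (w om i.+2 - wstar)
         = i%:R *: e - mu^-1 *: (g om i + mu *: wstar).
  apply/matrixP => k j; rewrite w_step /e /step_size !mxE -natr1.
  by field; rewrite mu_neq0 /= natr1 pnatr_eq0.
rewrite expr2 -mulrA -dotZl -dotZr {}E; clearbody e.
rewrite !(dotBl, dotBr, dotDl, dotDr, dotZl, dotZr) (dotC e (g om i)) (dotC e wstar)
  (dotC wstar (g om i)).
by field.
Qed.

Lemma mean_sqdist_step (i : 'I_T) :
  i.+1%:R ^+ 2 * mean_sqdist i.+1
  <= i%:R ^+ 2 * mean_sqdist i - 2 * i%:R / mu * mean_linear_gap i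
     + 37 / 4 * (D / mu) ^+ 2.
Proof.
have [D_ge0 muw] : 0 <= D /\ mu * norm2 wstar <= D.
  by split; [exact: loss_slope_ge0 | exact: norm2_wstar_le mean_abs_dot _ wstar_min].
have w_ge0 := norm2_ge0 wstar.
have mu_neq0 : mu != 0 by rewrite gt_eqF.
have c_ge0 : 0 <= 2 * i%:R / mu by rewrite divr_ge0 ?mulr_ge0 ?(ltW mu_gt0).
rewrite {1}/mean_sqdist -expectZ (eq_expect (sqdist_step^~ i)).
rewrite !(expectD, expectB, expectN, expectZ) expect_cst //.
set G := expect (fun om => dot (g om i) (w om i.+1 - wstar)).
set q := expect (fun om => dot (g om i) (g om i)).
set p := expect (fun om => dot (g om i) wstar).
set S := expect (fun om => dot wstar (w om i.+1 - wstar)).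
have gapE : mean_linear_gap i <= G + mu * S.
  rewrite /mean_linear_gap expectD expectB expectZ -/S expect_cst // lerD2r.
  exact: expect_run_subgradient_ge.
have noise : q + 2 * mu * p + mu ^+ 2 * dot wstar wstar <= 37 / 4 * D ^+ 2.
  have q_le : q <= 25 / 4 * D ^+ 2 := expect_run_sqr_subgradient_le i.
  have p_le : p <= D * norm2 wstar := expect_run_subgradient_dot_le i wstar.
  have : mu * p <= D * D.
    have := ler_wpM2l (ltW mu_gt0) p_le; have := ler_wpM2l D_ge0 muw.
    by lra.
  have : mu ^+ 2 * dot wstar wstar <= D ^+ 2.
    by rewrite -sqr_norm2 -exprMn lerXn2r ?nnegrE // mulr_ge0 // ltW.
  by lra.
apply: lerD.
  by rewrite /mean_sqdist -/S lerD2l lerN2 ler_wpM2l.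
rewrite (_ : 37 / 4 * (D / mu) ^+ 2 = mu ^- 2 * (37 / 4 * D ^+ 2)); last by field.
by rewrite ler_wpM2l // invr_ge0 exprn_ge0 // ltW.
Qed.

Definition mean_sqnorm n : R := expect (fun om => dot (w om n.+1) (w om n.+1)).

(** From the first step on, every iterate is a convex combination of vectors
    [- mu^-1 *: g om i]. *)
Lemma mean_sqnorm_le n : (n <= T)%N -> mean_sqnorm n <= 25 / 4 * (D / mu) ^+ 2.
Proof.
case: (run) => w1 _ w_step _; elim: n => [_|n IH nT].
  rewrite /mean_sqnorm (eq_expect (Y := fun=> 0)); last first.
    by move=> om; rewrite w1 dot0l.
  by rewrite expect_cst // mulr_ge0 ?sqr_ge0.
pose i := Ordinal nT; pose t : R := n.+1%:R^-1.
have mu_neq0 : mu != 0 by rewrite gt_eqF.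
have t01 : 0 <= t <= 1 by rewrite invr_ge0 ler0n invf_le1 ?ler1n ?ltr0n.
have stepE om : w om n.+2 = t *: (- mu^-1 *: g om i) + (1 - t) *: w om n.+1.
  rewrite (w_step om i) addrC /step_size /t -scaleNr scalerA /=.
  by congr (_ *: _ + _ *: _); field; rewrite mu_neq0 addrC natr1 pnatr_eq0.
have : mean_sqnorm n.+1 <=
    t * (mu ^- 2 * expect (fun om => dot (g om i) (g om i))) + (1 - t) * mean_sqnorm n.
  rewrite -!expectZ -expectD; apply: le_expect => om; rewrite stepE.
  apply: le_trans (sqnorm_convex _ _ t01) _.
  by rewrite dotZl dotZr mulrA -expr2 sqrrN exprVn.
move/le_trans; apply.
have q_le := expect_run_sqr_subgradient_le i.
set B := 25 / 4 * (D / mu) ^+ 2 in IH *.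
rewrite (_ : B = t * B + (1 - t) * B); last by ring.
case/andP: t01 => t0 t1; apply: lerD; rewrite ler_wpM2l ?subr_ge0 ?IH // 1?ltnW //.
rewrite (_ : B = mu ^- 2 * (25 / 4 * D ^+ 2)); last by rewrite /B; field.
by rewrite ler_wpM2l // invr_ge0 exprn_ge0 // ltW.
Qed.

Definition mean_gap n : R :=
  expect (fun om => objective x l mu (w om n.+1)) - objective x l mu wstar.

Lemma sum_mean_gap_le m : (0 < m)%N -> (m <= T)%N ->
  \sum_(m <= n < T) mean_gap n
  <= 37 / 8 * (D ^+ 2 / mu) * (m.+1%:R / m%:R + \sum_(m <= n < T) n%:R^-1).
Proof.
move=> m_gt0 mT; have mu_neq0 : mu != 0 by rewrite gt_eqF.
have c_gt0 : 0 < 2 / mu by rewrite divr_gt0.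
have M_ge0 : 0 <= 37 / 4 * (D / mu) ^+ 2 by rewrite mulr_ge0 ?sqr_ge0.
have step n : (n < T)%N -> n.+1%:R ^+ 2 * mean_sqdist n.+1
    <= n%:R ^+ 2 * mean_sqdist n - 2 / mu * n%:R * mean_linear_gap n
       + 37 / 4 * (D / mu) ^+ 2.
  by move=> nT; rewrite (mulrAC 2); apply: (mean_sqdist_step (Ordinal nT)).
have := recursion_sum mean_sqdist_ge0 mean_linear_gap_ge0 M_ge0 c_gt0 step m_gt0 mT.
rewrite -(ler_pM2l (_ : 0 < mu / 2)) ?divr_gt0 // mulr_sumr.
rewrite (eq_bigr mean_gap) => [|n _]; last first.
  by rewrite /mean_gap expect_objective_gapE; field.
move/le_trans; apply; rewrite mulrA; set H := _ + _.
by rewrite (_ : mu / 2 * _ = 37 / 8 * (D ^+ 2 / mu)) //; field.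
Qed.

Definition suffix_average m om : 'cV[R]_d :=
  (T - m)%:R^-1 *: \sum_(m <= n < T) w om n.+1.

Lemma suffix_average_gap_le m : (0 < m)%N -> (m < T)%N ->
  expect (fun om => objective x l mu (suffix_average m om)) - objective x l mu wstar
  <= (T - m)%:R^-1 * (37 / 8 * (D ^+ 2 / mu)
       * (m.+1%:R / m%:R + \sum_(m <= n < T) n%:R^-1)).
Proof.
move=> m_gt0 mT; have Tm : (T - m)%:R != 0 :> R by rewrite pnatr_eq0 subn_eq0 -ltnNge.
have := sum_mean_gap_le m_gt0 (ltnW mT).
rewrite -(ler_pM2l (_ : 0 < (T - m)%:R^-1)); last by rewrite invr_gt0 ltr0n subn_gt0.
apply: le_trans; rewrite /mean_gap sumrB sumr_const_nat mulrBr.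
rewrite -[objective _ _ _ _ *+ _]mulr_natl mulKf //.
rewrite lerD2r -expect_sum -expectZ; apply: le_expect => om.
have := jensen_seq (objective_convex x mu_gt0 l_convex) (r := index_iota m T)
  (fun n => w om n.+1).
by rewrite size_iota subn_gt0; apply.
Qed.

Lemma suffix_average_sqnorm_le m : (m < T)%N ->
  expect (fun om => dot (suffix_average m om) (suffix_average m om))
  <= 25 / 4 * (D / mu) ^+ 2.
Proof.
move=> mT; have Tm : 0 < (T - m)%:R :> R by rewrite ltr0n subn_gt0.
apply: (@le_trans _ _ ((T - m)%:R^-1 * \sum_(m <= n < T) mean_sqnorm n)).
  rewrite -expect_sum -expectZ; apply: le_expect => om.
  have := jensen_seq (f := fun u => dot u u) (fun t u v => @sqnorm_convex _ _ t u v)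
    (r := index_iota m T) (fun n => w om n.+1).
  by rewrite size_iota subn_gt0; apply.
rewrite ler_pdivrMl //; apply: (@le_trans _ _ (\sum_(m <= n < T) 25 / 4 * (D / mu) ^+ 2)).
  rewrite !big_nat; apply: ler_sum => n /andP[_ nT].
  by apply: mean_sqnorm_le; apply: ltnW.
by rewrite sumr_const_nat -[leLHS]mulr_natl.
Qed.

Lemma outputE om : (0 < T)%N ->
  output T (w om) = (2 * (T - T %/ 2)%:R / T%:R) *: suffix_average (T %/ 2) om.
Proof.
move=> T_gt0; have Tm : (T - T %/ 2)%:R != 0 :> R.
  by rewrite pnatr_eq0 subn_eq0 -ltnNge ltn_Pdiv.
rewrite /output /suffix_average big_add1 scalerA; congr (_ *: _).
by field; rewrite Tm pnatr_eq0 -lt0n.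
Qed.

(** The weight [3/20] in the arithmetic-geometric inequality is the best one for
    [c = 4 / 3], which is the case of three iterations. *)
Lemma scaled_gap_le m c : (m < T)%N ->
  expect (fun om => objective x l mu (c *: suffix_average m om))
    - objective x l mu wstar
  <= (13 / 6 + 65 / 16 * c ^+ 2) * (D ^+ 2 / mu).
Proof.
move=> mT; have mu_neq0 : mu != 0 by rewrite gt_eqF.
have c_gt0 : 0 < 3 / 20 * mu by rewrite mulr_gt0.
have := ler_wpM2l (_ : 0 <= 13 / 20 * mu * c ^+ 2) (suffix_average_sqnorm_le mT).
rewrite mulr_ge0 ?sqr_ge0 ?mulr_ge0 ?(ltW mu_gt0) // => /(_ isT) h.
apply: (@le_trans _ _ (13 / 6 * (D ^+ 2 / mu) + 13 / 20 * mu * c ^+ 2 *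
   expect (fun om => dot (suffix_average m om) (suffix_average m om)))).
  rewrite -[X in _ - X <= _](expect_cst _ draws_gt0).
  rewrite -[X in _ <= X + _](expect_cst _ draws_gt0) -expectZ -expectD -expectB.
  apply: le_expect => om; set u := suffix_average m om.
  apply: le_trans (objective_gap_le L_gt0 mu_gt0 l_lipschitz kappa_ge0 mean_abs_dot _ _) _.
  rewrite -/D dotZl dotZr.
  have : D * norm2 (c *: u) <= 3 / 20 * mu * (c ^+ 2 * dot u u)
                               + D ^+ 2 / (4 * (3 / 20 * mu)).
    apply: le_amgm; [by [] | exact: sqr_ge0 | |].
      by rewrite mulr_ge0 ?sqr_ge0 ?dot_ge0.
    by rewrite exprMn sqr_norm2 dotZl dotZr mulrA -expr2.
  rewrite (_ : D ^+ 2 / (4 * _) = 5 / 3 * (D ^+ 2 / mu)); last by field.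
  rewrite (_ : D ^+ 2 / (2 * mu) = 1 / 2 * (D ^+ 2 / mu)); last by field.
  lra.
rewrite [leRHS]mulrDl lerD2l (le_trans h) //.
by rewrite (_ : _ * (25 / 4 * _) = 65 / 16 * c ^+ 2 * (D ^+ 2 / mu)) //; field.
Qed.

Lemma scaled_excess_le m c : (m < T)%N -> 1 <= c ->
  expect (fun om => objective x l mu (c *: suffix_average m om))
  - expect (fun om => objective x l mu (suffix_average m om))
  <= (5 / 2 * (c - 1) + 25 / 8 * (c ^+ 2 - 1)) * (D ^+ 2 / mu).
Proof.
move=> mT c1; have mu_neq0 : mu != 0 by rewrite gt_eqF.
have c_gt0 : 0 < 1 / 5 * mu by rewrite mulr_gt0.
have a_ge0 : 0 <= (c - 1) * (1 / 5 * mu) + mu / 2 * (c ^+ 2 - 1).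
  have cc : 1 <= c ^+ 2 by rewrite exprn_ege1.
  by rewrite addr_ge0 // mulr_ge0 ?subr_ge0 ?divr_ge0 // ltW.
have h := ler_wpM2l a_ge0 (suffix_average_sqnorm_le mT).
apply: (@le_trans _ _ ((c - 1) * (5 / 4 * (D ^+ 2 / mu)) +
   ((c - 1) * (1 / 5 * mu) + mu / 2 * (c ^+ 2 - 1)) *
   expect (fun om => dot (suffix_average m om) (suffix_average m om)))).
  rewrite -[X in _ <= X + _](expect_cst _ draws_gt0) -expectZ -expectD -expectB.
  apply: le_expect => om; set u := suffix_average m om.
  apply: le_trans (objective_scale_le mu L_gt0 l_lipschitz kappa_ge0 mean_abs_dot _ c1) _.
  rewrite -/D [leRHS](_ : _ = (c - 1) * (1 / 5 * mu * dot u u + D ^+ 2 / (4 * (1 / 5 * mu)))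
                       + mu / 2 * (c ^+ 2 - 1) * dot u u); last by field.
  rewrite lerD2r ler_wpM2l ?subr_ge0 //.
  apply: le_amgm; [by [] | exact: sqr_ge0 | exact: dot_ge0 |].
  by rewrite exprMn sqr_norm2.
rewrite [leRHS](_ : _ = (c - 1) * (5 / 4 * (D ^+ 2 / mu))
  + ((c - 1) * (1 / 5 * mu) + mu / 2 * (c ^+ 2 - 1)) * (25 / 4 * (D / mu) ^+ 2)).
  by rewrite lerD2l.
by field.
Qed.

Let E0 := D ^+ 2 / mu.

Let E0_ge0 : 0 <= E0. Proof. by rewrite divr_ge0 ?sqr_ge0 // ltW. Qed.

Lemma run_bound_even m : T = m.+1.*2 ->
  expect (fun om => objective x l mu (output T (w om))) - objective x l mu wstar
  <= 30 * E0 / T%:R.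
Proof.
move=> Teq; have half : (T %/ 2 = m.+1)%N by rewrite Teq divn2 doubleK.
have T_sub : (T - m.+1 = m.+1)%N by rewrite Teq -addnn addnK.
have T_gt : (m.+1 < T)%N by rewrite Teq -addnn -[X in (X < _)%N]addn0 ltn_add2l.
have m_pos : 0 < m.+1%:R :> R by rewrite ltr0n.
have TE : T%:R = 2 * m.+1%:R :> R by rewrite Teq -muln2 natrM mulrC.
rewrite (eq_expect (Y := fun om => objective x l mu (suffix_average m.+1 om))).
  apply: le_trans (suffix_average_gap_le _ T_gt) _ => //.
  rewrite T_sub TE -/E0 [leRHS](_ : _ = m.+1%:R^-1 * (15 * E0)); last first.
    by field; rewrite gt_eqF.
  rewrite ler_wpM2l ?invr_ge0 ?ler0n //.
  have S1 : \sum_(m.+1 <= n < T) (n%:R^-1 : R) <= 1.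
    by rewrite Teq sum_inv_double_le1.
  have m2 : m.+2%:R / m.+1%:R <= 2 :> R.
    by rewrite ler_pdivrMr // -natrM ler_nat mul2n -addnn addSn ltnS leq_addl.
  move: S1 m2; set s := \sum_(_ <= _ < _) _; set a := _ / _ => S1 m2.
  have : E0 * (a + s) <= E0 * 3 by rewrite ler_wpM2l //; lra.
  by have := E0_ge0; lra.
move=> om; rewrite outputE ?(leq_trans _ T_gt) // half T_sub TE divff ?scale1r //.
Qed.

(** Here [m + 3] iterates are summed and [T = 2 * m + 5], so the output is
    [1 + 1 / T] times their average. *)
Lemma run_bound_odd_large m : T = m.+2.*2.+1 ->
  expect (fun om => objective x l mu (output T (w om))) - objective x l mu wstar
  <= 30 * E0 / T%:R.
Proof.
move=> Teq; have half : (T %/ 2 = m.+2)%N by rewrite Teq divn2 /= uphalf_double.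
have T_sub : (T - m.+2 = m.+3)%N by rewrite Teq -addnn -addnS addKn.
have T_gt : (m.+2 < T)%N by rewrite Teq ltnS -addnn leq_addr.
have m_pos : 0 < m.+2%:R :> R by rewrite ltr0n.
have m_ge0 : 0 <= m%:R :> R by [].
have TE : T%:R = 2 * m%:R + 5 :> R.
  by rewrite Teq -addn1 -muln2 natrD natrM -addn2 natrD; ring.
have T_pos : 0 < T%:R :> R by rewrite TE ltr_wpDl // mulr_ge0.
have mE : m.+2%:R = m%:R + 2 :> R by rewrite -addn2 natrD.
have m3E : m.+3%:R = m%:R + 3 :> R by rewrite -addn3 natrD.
pose c : R := 1 + T%:R^-1.
rewrite (eq_expect (Y := fun om => objective x l mu (c *: suffix_average m.+2 om))).
  have c1 : 1 <= c by rewrite lerDl invr_ge0 ltW.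
  have excess := scaled_excess_le T_gt c1.
  have average := suffix_average_gap_le (isT : (0 < m.+2)%N) T_gt.
  rewrite T_sub -/E0 in average; rewrite -/E0 in excess.
  pose r : R := m.+2%:R^-1; pose z : R := T%:R^-1.
  have z_ge0 : 0 <= z by rewrite invr_ge0 ltW.
  have r_half : r <= 1 / 2.
    by rewrite /r mul1r lef_pV2 ?posrE // ler_nat.
  have z_fifth : z <= 1 / 5.
    by rewrite /z mul1r lef_pV2 ?posrE // Teq ler_nat.
  have rz : r = 2 * z + r * z.
    by rewrite /r /z TE mE; field; rewrite !gt_eqF //; lra.
  have S_le : \sum_(m.+2 <= n < T) (n%:R^-1 : R) <= 3 / 4 * (m.+3%:R * r).
    by rewrite Teq sum_inv_double_succ_le.
  have average' : m.+3%:R^-1 * (37 / 8 * E0 *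
      (m.+3%:R / m.+2%:R + \sum_(m.+2 <= n < T) n%:R^-1)) <= 259 / 32 * r * E0.
    rewrite ler_pdivrMl ?ltr0n //.
    rewrite [leRHS](_ : _ = 37 / 8 * E0 * (m.+3%:R * r + 3 / 4 * (m.+3%:R * r))).
      by rewrite ler_wpM2l ?lerD2l // mulr_ge0.
    by field.
  have rz_le : r * z <= 1 / 2 * z by rewrite ler_wpM2r.
  have zz_le : z * z <= 1 / 5 * z by rewrite ler_wpM2r.
  have coef : 259 / 32 * r + (5 / 2 * (c - 1) + 25 / 8 * (c ^+ 2 - 1)) <= 30 * z.
    have -> : c = 1 + z by [].
    by lra.
  have := ler_wpM2r E0_ge0 coef; rewrite mulrDl => coefE.
  rewrite -/z mulrAC; move: (le_trans average average') excess coefE; lra.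
move=> om; rewrite outputE ?(leq_trans _ T_gt) // half T_sub.
congr (objective _ _ _ (_ *: _)).
by rewrite /c TE m3E; field; rewrite gt_eqF //; lra.
Qed.

(** For one and three iterations the normalization [2 / T] inflates the average
    by [2] and [4 / 3]; the bound on the second moments of the iterates is then
    stronger than the recursion. *)
Lemma run_bound_odd_small : T = 1%N \/ T = 3%N ->
  expect (fun om => objective x l mu (output T (w om))) - objective x l mu wstar
  <= 30 * E0 / T%:R.
Proof.
move=> Tsmall; have T_gt0 : (0 < T)%N by case: Tsmall => ->.
have T_gt : (T %/ 2 < T)%N by rewrite ltn_Pdiv.
rewrite (eq_expect (fun om => congr1 (objective x l mu) (outputE om T_gt0))).
apply: le_trans (scaled_gap_le _ T_gt) _; rewrite -/E0 [leRHS]mulrAC ler_wpM2r //.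
case: Tsmall => ->; first by rewrite (_ : (1 - 1 %/ 2 = 1)%N) //; lra.
by rewrite (_ : (3 - 3 %/ 2 = 2)%N) //; lra.
Qed.

Lemma run_bound : (0 < T)%N ->
  expect (fun om => objective x l mu (output T (w om))) - objective x l mu wstar
  <= 30 * E0 / T%:R.
Proof.
move=> T_gt0; have := odd_double_half T; case: (odd T) => /= Teq.
  case: T./2 Teq => [|[|m]] Teq.
  - by apply: run_bound_odd_small; left; rewrite -Teq.
  - by apply: run_bound_odd_small; right; rewrite -Teq.
  - by apply: (@run_bound_odd_large m); rewrite -Teq.
case: T./2 Teq => [|m] Teq; first by move: (T_gt0); rewrite -{1}Teq.
by apply: (@run_bound_even m); rewrite -Teq.
Qed.

End Run.

(** * The convergence rate *)

Theorem theorem5p1 (R : realType) (d N b T : nat) (x : 'I_N -> 'cV[R]_d)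
    (l : R -> R) (L mu : R) (wstar : 'cV[R]_d)
    (w : draws N b T -> nat -> 'cV[R]_d)
    (g : draws N b T -> 'I_T -> 'cV[R]_d)
    (b_gt0 : (0 < b)%N) (b_le_N : (b <= N)%N) (T_gt0 : (0 < T)%N)
    (x_le1 : forall i, norm2 (x i) <= 1)
    (l_convex : convex_function [set: R^o] (l : R^o -> R^o))
    (L_gt0 : 0 < L)
    (l_lipschitz : L.-lipschitz (l : R^o -> R^o))
    (mu_gt0 : 0 < mu)
    (wstar_min : forall v, objective x l mu wstar <= objective x l mu v)
    (run : minibatch_run x l mu w g) :
  forall K : R,
    K = expect (fun A : batch N b =>
                  spectral_norm (principal_submx (gram x) (val A)))
    \/ K = 1 + (b%:R - 1) * (N%:R * rho2 x - 1) / (N%:R - 1) ->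
    expect (fun om : draws N b T => objective x l mu (output T (w om)))
      - objective x l mu wstar
    <= 30 * L ^+ 2 / mu * (K / b%:R) * (1 / T%:R).
Proof.
move=> K HK; pose kappa := K / b%:R.
have b_pos : 0 < b%:R :> R by rewrite ltr0n.
have N_pos : 0 < N%:R :> R by rewrite ltr0n (leq_trans b_gt0).
have K_eq : K = kappa * b%:R by rewrite divfK ?gt_eqF.
(* Both values of [K] enter only through these bounds: a Lipschitz constant of
   the average loss, and a second moment, uniformly over the weights. *)
suff [kappa_ge0 [mean_abs_dot second_moment]] : 0 <= kappa /\
    (forall v, expect (fun i => `|dot v (x i)|) ^+ 2 <= kappa * dot v v) /\
    (forall s : batch N b -> 'I_N -> R, unit_weights s ->
       expect (fun A => dot (batch_sum x s A) (batch_sum x s A))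
       <= 25 / 4 * kappa * b%:R ^+ 2).
  have := run_bound b_gt0 b_le_N L_gt0 mu_gt0 l_convex l_lipschitz wstar_min run
    kappa_ge0 mean_abs_dot second_moment T_gt0.
  rewrite /loss_slope exprMn sqr_sqrtr //; move/le_trans; apply.
  by rewrite le_eqVlt; apply/orP; left; apply/eqP; rewrite /kappa; ring.
case: HK => KE.
  have K_ge0 : 0 <= kappa.
    rewrite divr_ge0 // KE; apply: expect_ge0 => A; exact: spectral_norm_ge0.
  have moment (s : batch N b -> 'I_N -> R) : unit_weights s ->
      expect (fun A => dot (batch_sum x s A) (batch_sum x s A)) <= kappa * b%:R ^+ 2.
    move=> s1; apply: le_trans (expect_batch_sum_spectral x s1) _.
    by rewrite -KE expr2 mulrA -K_eq mulrC.
  split=> //; split=> [v|s s1]; first exact: (sqr_expect_dot_le b_gt0 b_le_N).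
  apply: le_trans (moment s s1) _; rewrite -mulrA ler_peMl //.
    by rewrite mulr_ge0 // sqr_ge0.
  by lra.
have rho_le : rho2 x <= kappa.
  by rewrite ler_pdivlMr // mulrC KE rho2_le_mean_spectral_bound.
split; first exact: le_trans (rho2_ge0 x) rho_le.
split=> [v|s s1].
  rewrite /expect card_ord expr_div_n ler_pdivrMr ?exprn_gt0 //.
  apply: le_trans (sum_abs_dot_le x (leq_trans b_gt0 b_le_N) v) _.
  rewrite -mulrA mulrC ler_wpM2r ?sqr_ge0 //.
  by rewrite ler_wpM2r ?dot_ge0.
apply: le_trans (expect_batch_sum_mean x_le1 b_gt0 b_le_N s1) _.
rewrite [leRHS](_ : _ = 25 / 4 * (b%:R * (kappa * b%:R))); last by ring.
by rewrite -K_eq /mean_spectral_bound -KE.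
Qed.
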